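(* Let $(R,\mathfrak{m},k)$ be a commutative noetherian local Cohen--Macaulay ring with a dualizing module $\Omega$. The following conditions are equivalent. (i) For every finitely generated $R$-module $M$, the module $\operatorname{Hom}_R(M,\Omega)$ is maximal CM. (ii) The Krull dimension of $R$ is $\leqslant 2$. (iii) The inclusion functor $\mathsf{MCM}\hookrightarrow\mathsf{mod}$ has a left adjoint. (iv) Every finitely generated $R$-module has an $\mathsf{MCM}$-envelope with the unique lifting property.
   Context: $R$ is a commutative noetherian local Cohen--Macaulay ring with maximal ideal $\mathfrak{m}$, residue field $k$, Krull dimension $d$, and a dualizing (canonical) module $\Omega$. For a finitely generated $R$-module $M$, $\operatorname{depth}_R M=\inf\{i \mid \operatorname{Ext}^i_R(k,M)\neq 0\}\in\mathbb{N}_0\cup\{\infty\}$. A finitely generated $R$-module $M$ is called maximal Cohen--Macaulay (maximal CM) if $\operatorname{depth}_R M\geqslant d$ (so the zero module is maximal CM). $\mathsf{mod}$ denotes the category of finitely generated $R$-modules and $\mathsf{MCM}$ its full subcategory of maximal CM modules. Let $M$ be a finitely generated $R$-module. An $\mathsf{MCM}$-preenvelope of $M$ is a homomorphism $\mu\colon M\to X$ with $X\in\mathsf{MCM}$ such that for every $Y\in\mathsf{MCM}$ the map $\operatorname{Hom}_R(\mu,Y)\colon\operatorname{Hom}_R(X,Y)\to\operatorname{Hom}_R(M,Y)$ is surjective. It is an $\mathsf{MCM}$-envelope if, moreover, every endomorphism $\varphi$ of $X$ with $\varphi\mu=\mu$ is an automorphism. An $\mathsf{MCM}$-(pre)envelope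 $\mu\colon M\to X$ has the unique lifting property if $\operatorname{Hom}_R(\mu,Y)$ is an isomorphism for every $Y\in\mathsf{MCM}$, i.e. every homomorphism $\nu\colon M\to Y$ with $Y\in\mathsf{MCM}$ can be written as $\nu=\varphi\mu$ for a unique homomorphism $\varphi\colon X\to Y$. *)

(* Defs.v *)
From HB Require Import structures.
From mathcomp Require Import all_boot all_order all_algebra.
From mathcomp Require Import boolp classical_sets functions.
From mathcomp Require Import freeg.
Import GRing.Theory.
Set Implicit Arguments.
Unset Strict Implicit.
Unset Printing Implicit Defensive.
Local Open Scope classical_set_scope.
Local Open Scope ring_scope.
Local Open Scope quotient_scope.

Lemma linear_ext (R : comNzRingType) (M N : lmodType R)
  (f g : {linear M -> N}) : f =1 g -> f = g.
Proof.
case: f g => f [[f1] [f2]] [g [[g1] [g2]]] /= /funext fg; subst g.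
congr (GRing.Linear.Pack (GRing.Linear.Class _ _)).
  by congr (Algebra.isNmodMorphism.Axioms_ _); exact: Prop_irrelevance.
by congr (GRing.isScalable.Axioms_ _); exact: Prop_irrelevance.
Qed.

Section FreeModule.
Variables (R : comNzRingType) (K : choiceType) (M : lmodType R) (f : K -> M).

Lemma fglift_linear : linear (fglift f : {freeg K / R} -> M).
Proof.
pose h := GRing.isZmodMorphism.Build _ _ (fglift f) (@lift_is_additive R K M f).
pose A : {additive {freeg K / R} -> M} := HB.pack (fglift f) h.
have sumA : forall s (F : K -> {freeg K / R}),
    fglift f (\sum_(x <- s) F x) = \sum_(x <- s) fglift f (F x).
  by move=> s F; exact: (raddf_sum A).
move=> c D E; rewrite [LHS](raddfD A) /=; congr (_ + _).
rewrite -[c *: D]/(\sum_(x <- dom D) << c * coeff x D *g x >>).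
rewrite [LHS]sumA -[in RHS](freeg_sumE D) [in RHS]sumA scaler_sumr.
by apply: eq_bigr => z _ /=; rewrite !liftU scalerA.
Qed.

HB.instance Definition _ := GRing.isLinear.Build R {freeg K / R} M *:%R
  (fglift f) fglift_linear.
End FreeModule.

Section Submodules.
Variables (R : comNzRingType) (V : lmodType R).

Definition submod (S : submodClosed V) : Type := {x : V | x \in S}.

Section Sub.
Variable S : submodClosed V.
HB.instance Definition _ := [isSub for (@sval V _ : submod S -> V)].
HB.instance Definition _ := [Choice of submod S by <:].
HB.instance Definition _ := [SubChoice_isSubLmodule of submod S by <:].
End Sub.

Section Quotient.
Variable S : submodClosed V.

Definition submod_eqv (x y : V) : bool := x - y \in S.

Lemma submod_eqv_equiv : equiv_class_of submod_eqv.
Proof.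
have SN z : z \in S -> - z \in S by move=> zS; rewrite -scaleN1r rpredZ.
split=> [x|x y|y x z]; rewrite /submod_eqv ?subrr ?rpred0 //.
  by apply/idP/idP => /SN; rewrite opprB.
by move=> xy yz; rewrite -[x](subrK y) -addrA rpredD.
Qed.

Canonical submod_equiv := EquivRelPack submod_eqv_equiv.
Canonical submod_encModRel := defaultEncModRel submod_eqv.

Definition quotmod : Type := {eq_quot submod_eqv}.
HB.instance Definition _ := Choice.on quotmod.
HB.instance Definition _ := EqQuotient.on quotmod.

Lemma quotmodP x y : reflect (\pi_quotmod x = \pi_quotmod y) (x - y \in S).
Proof. exact: (@eqquotP _ submod_equiv). Qed.

Definition quotmod_zero : quotmod := \pi_quotmod 0.
Definition quotmod_add (x y : quotmod) : quotmod := \pi_quotmod (repr x + repr y).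
Definition quotmod_opp (x : quotmod) : quotmod := \pi_quotmod (- repr x).
Definition quotmod_scale c (x : quotmod) : quotmod := \pi_quotmod (c *: repr x).

Let reprB x : repr (\pi_quotmod x) - x \in S.
Proof. by apply/quotmodP; rewrite reprK. Qed.

Let piD x y : quotmod_add (\pi_quotmod x) (\pi_quotmod y) = \pi_quotmod (x + y).
Proof. by apply/quotmodP; rewrite opprD addrACA rpredD. Qed.

Let piZ c x : quotmod_scale c (\pi_quotmod x) = \pi_quotmod (c *: x).
Proof. by apply/quotmodP; rewrite -scalerBr rpredZ. Qed.

Let piN x : quotmod_opp (\pi_quotmod x) = \pi_quotmod (- x).
Proof.
by rewrite -!scaleN1r -piZ /quotmod_opp /quotmod_scale scaleN1r.
Qed.

Let addA : associative quotmod_add.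
Proof. 
move=> x y z; rewrite -[x]reprK -[y]reprK -[z]reprK.
by rewrite (piD (repr y) (repr z)) (piD (repr x) (repr y)) 2!piD addrA. Qed.
Let addC : commutative quotmod_add.
Proof. by move=> x y; rewrite -[x]reprK -[y]reprK !piD addrC. Qed.
Let add0 : left_id quotmod_zero quotmod_add.
Proof. by move=> x; rewrite -[x]reprK piD add0r. Qed.
Let addN : left_inverse quotmod_zero quotmod_opp quotmod_add.
Proof. by move=> x; rewrite -[x]reprK (piN (repr x)) piD addNr. Qed.
HB.instance Definition _ := GRing.isZmodule.Build quotmod addA addC add0 addN.

Let scaleA a b x : quotmod_scale a (quotmod_scale b x) = quotmod_scale (a * b) x.
Proof. by rewrite -[x]reprK (piZ b (repr x)) 2!piZ scalerA. Qed.
Let scale1 : left_id 1 quotmod_scale.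
Proof. by move=> x; rewrite -[x]reprK piZ scale1r. Qed.
Let scaleD : right_distributive quotmod_scale +%R.
Proof.
move=> c x y; rewrite -[x]reprK -[y]reprK.
by rewrite [X in quotmod_scale c X]piD !piZ [RHS]piD scalerDr.
Qed.
Let scaleDl x : {morph quotmod_scale^~ x : a b / a + b}.
Proof. by move=> a b; rewrite -[x]reprK !piZ [RHS]piD scalerDl. Qed.
HB.instance Definition _ :=
  GRing.Zmodule_isLmodule.Build R quotmod scaleA scale1 scaleD scaleDl.

Definition quot_proj : V -> quotmod := \pi_quotmod.
Lemma quot_proj_linear : linear quot_proj.
Proof. 
move=> c x y; rewrite /quot_proj.
rewrite -[RHS]/(quotmod_add (quotmod_scale c (\pi_quotmod x)) (\pi_quotmod y)).
by rewrite piZ piD. Qed.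
HB.instance Definition _ :=
  GRing.isLinear.Build R V quotmod *:%R quot_proj quot_proj_linear.
End Quotient.
End Submodules.

Section Homology.
Variables (R : comNzRingType) (A B C : lmodType R).
Variables (f : {linear A -> B}) (g : {linear B -> C}).

Definition ker_pred : B -> bool := fun y => g y == 0.

Lemma ker_pred_closed : subsemimod_closed ker_pred.
Proof.
split; first split; rewrite /ker_pred.
- by rewrite unfold_in linear0.
- by move=> x y; rewrite !unfold_in linearD => /eqP -> /eqP ->; rewrite addr0.
- by move=> c x; rewrite !unfold_in linearZ => /eqP ->; rewrite /= scaler0.
Qed.

HB.instance Definition _ :=
  GRing.isSubSemiModClosed.Build R B ker_pred ker_pred_closed.

Definition ker : submodClosed B := GRing.SubmodClosed.clone R B ker_pred _.

Definition bound_pred : submod ker -> bool :=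
  fun z => `[< exists x, f x = val z >].

Lemma bound_pred_closed : subsemimod_closed bound_pred.
Proof.
split; first split; rewrite /bound_pred.
- by rewrite unfold_in; apply/asboolP; exists 0; rewrite !linear0.
- move=> x y; rewrite !unfold_in => /asboolP[a fa] /asboolP[b fb].
  by apply/asboolP; exists (a + b); rewrite !linearD /= fa fb.
- move=> c x; rewrite !unfold_in => /asboolP[a fa].
  by apply/asboolP; exists (c *: a); rewrite !linearZ /= fa.
Qed.

HB.instance Definition _ :=
  GRing.isSubSemiModClosed.Build R (submod ker) bound_pred bound_pred_closed.

(* ker g / im f; in all uses g \o f = 0 *)
Definition homology : lmodType R := quotmod (GRing.SubmodClosed.clone R (submod ker) bound_pred _).
End Homology.

Section HomModule.
Variables (R : comNzRingType) (M N : lmodType R).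

(* The alias keeps the instances below apart from those that other libraries
   may declare on {linear M -> N} itself. *)
Definition HomR : Type := {linear M -> N}.

HB.instance Definition _ := gen_eqMixin HomR.
HB.instance Definition _ := gen_choiceMixin HomR.

Definition hom0 : HomR := \0 : {linear M -> N}.
Definition homD (f g : HomR) : HomR :=
  (f : {linear M -> N}) \+ (g : {linear M -> N}) : {linear M -> N}.
Definition homN (f : HomR) : HomR := \- (f : {linear M -> N}) : {linear M -> N}.
Definition homZ (c : R) (f : HomR) : HomR :=
  c \*: (f : {linear M -> N}) : {linear M -> N}.

Let homDA : associative homD.
Proof. by move=> f g h; apply: linear_ext => x /=; rewrite addrA. Qed.
Let homDC : commutative homD.
Proof. by move=> f g; apply: linear_ext => x /=; rewrite addrC. Qed.
Let hom0D : left_id hom0 homD.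
Proof. by move=> f; apply: linear_ext => x /=; rewrite add0r. Qed.
Let homND : left_inverse hom0 homN homD.
Proof. by move=> f; apply: linear_ext => x /=; rewrite addNr. Qed.
HB.instance Definition _ := GRing.isZmodule.Build HomR homDA homDC hom0D homND.

Let homZA a b f : homZ a (homZ b f) = homZ (a * b) f.
Proof. by apply: linear_ext => x /=; rewrite scalerA. Qed.
Let hom1Z : left_id 1 homZ.
Proof. by move=> f; apply: linear_ext => x /=; rewrite scale1r. Qed.
Let homZDr : right_distributive homZ +%R.
Proof. by move=> c f g; apply: linear_ext => x /=; rewrite scalerDr. Qed.
Let homZDl (f : HomR) : {morph homZ^~ f : a b / a + b}.
Proof. by move=> a b; apply: linear_ext => x /=; rewrite scalerDl. Qed.
HB.instance Definition _ :=
  GRing.Zmodule_isLmodule.Build R HomR homZA hom1Z homZDr homZDl.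
End HomModule.

Section Precomposition.
Variables (R : comNzRingType) (M N Y : lmodType R) (u : {linear M -> N}).

Definition precomp (f : HomR N Y) : HomR M Y :=
  (f : {linear N -> Y}) \o u : {linear M -> Y}.

Lemma precomp_linear : linear precomp.
Proof. by move=> c f g; apply: linear_ext. Qed.

HB.instance Definition _ :=
  GRing.isLinear.Build R (HomR N Y) (HomR M Y) *:%R precomp precomp_linear.
End Precomposition.
Arguments precomp {R M N} Y u f.

Section Resolutions.
Variable R : comNzRingType.
Implicit Types M N X Y E P : lmodType R.

Definition exact_at M N X (f : {linear M -> N}) (g : {linear N -> X}) : Prop :=
  forall y : N, g y = 0 <-> exists x : M, f x = y.

Definition projective P : Prop :=
  forall M N (p : {linear M -> N}) (f : {linear P -> N}),
    (forall y, exists x, p x = y) -> exists g : {linear P -> M}, p \o g =1 f.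

Definition injective_module E : Prop :=
  forall M N (i : {linear M -> N}) (f : {linear M -> E}),
    injective i -> exists g : {linear N -> E}, g \o i =1 f.

Record proj_resolution N := ProjResolution {
  pr_mod : nat -> lmodType R;
  pr_diff : forall i, {linear pr_mod i.+1 -> pr_mod i};
  pr_aug : {linear pr_mod 0%N -> N};
  pr_projective : forall i, projective (pr_mod i);
  pr_aug_surj : forall y, exists x, pr_aug x = y;
  pr_exact0 : exact_at (pr_diff 0%N) pr_aug;
  pr_exact : forall i, exact_at (pr_diff i.+1) (pr_diff i)
}.

Record inj_resolution N := InjResolution {
  ir_mod : nat -> lmodType R;
  ir_diff : forall i, {linear ir_mod i -> ir_mod i.+1};
  ir_aug : {linear N -> ir_mod 0%N};
  ir_injective : forall i, injective_module (ir_mod i);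
  ir_aug_inj : injective ir_aug;
  ir_exact0 : exact_at ir_aug (ir_diff 0%N);
  ir_exact : forall i, exact_at (ir_diff i) (ir_diff i.+1)
}.

Definition fin_inj_dim N : Prop :=
  exists (I : inj_resolution N) (n : nat),
    forall i, (n < i)%N -> forall x : ir_mod I i, x = 0.

Lemma free_projective (K : choiceType) : projective {freeg K / R}.
Proof.
move=> M N p f p_surj.
have [s sP] := choice (fun k : K => p_surj (f << k >>)).
exists (fglift s : {linear {freeg K / R} -> M}) => D /=.
rewrite -(freeg_sumE D) !linear_sum; apply: eq_bigr => k _.
have -> : << coeff k D *g k >> = coeff k D *: << k >> :> {freeg K / R}.
  by apply/eqP/freeg_eqP => z; rewrite coeffZ !coeffU mul1r.
by rewrite !linearZ /= liftU scale1r sP.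
Qed.

(* The canonical free resolution: R^(N) ->> N, and repeat with the kernel. *)
Definition cover N : {linear {freeg N / R} -> N} := fglift id.

Lemma cover_surj N y : exists x, cover N x = y.
Proof. by exists << y >>; rewrite /= liftU scale1r. Qed.

Definition syzygy N (i : nat) : lmodType R :=
  iter i (fun M : lmodType R => submod (ker (cover M)) : lmodType R) N.

Definition free_diff N i :
    {linear {freeg (syzygy N i.+1) / R} -> {freeg (syzygy N i) / R}} :=
  (val : {linear submod (ker (cover (syzygy N i))) -> _})
  \o cover (syzygy N i.+1).

Lemma cover_exact N i : exact_at (free_diff N i) (cover (syzygy N i)).
Proof.
move=> y; split=> [y0|[x <-]].
  have yker : y \in ker (cover (syzygy N i)) by rewrite unfold_in; apply/eqP.
  by have [x xE] := cover_surj (exist _ y yker : syzygy N i.+1); exists x; rewrite /= xE.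
exact/eqP/(valP (cover (syzygy N i.+1) x : submod (ker (cover (syzygy N i))))).
Qed.

Lemma free_exact N i : exact_at (free_diff N i.+1) (free_diff N i).
Proof.
move=> y; rewrite -cover_exact /=; split=> [y0|-> //].
by apply: val_inj; exact: y0.
Qed.

Definition free_resolution N : proj_resolution N :=
  ProjResolution (fun i => @free_projective (syzygy N i)) (@cover_surj N)
    (@cover_exact N 0%N) (@free_exact N).

Definition Hom_diff N (P : proj_resolution N) M i :
    {linear HomR (pr_mod P i) M -> HomR (pr_mod P i.+1) M} :=
  precomp M (pr_diff P i).

(* H^i(Hom_R(P, M)) *)
Definition Hom_cohomology N (P : proj_resolution N) (i : nat) M : lmodType R :=
  match i with
  | 0%N => homology (\0 : {linear HomR (pr_mod P 0) M -> HomR (pr_mod P 0) M})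
             (Hom_diff P M 0)
  | j.+1 => homology (Hom_diff P M j) (Hom_diff P M j.+1)
  end.

Definition Ext i N M : lmodType R := Hom_cohomology (free_resolution N) i M.

End Resolutions.

Section RingNotions.
Variable R : comNzRingType.
Implicit Types (M N X : lmodType R) (I J p m : submodClosed R^o).

Definition fin_gen M : Prop :=
  exists (n : nat) (e : 'I_n -> M),
    forall x, exists c : 'I_n -> R, x = \sum_(i < n) c i *: e i.

Definition noetherian : Prop := forall I, fin_gen (submod I).

Definition proper I : Prop := (1 : R^o) \notin I.

Definition prime_ideal p : Prop :=
  proper p /\ prime_idealr_closed (p : {pred R}).

Definition maximal_ideal m : Prop :=
  proper m /\ forall J, proper J -> {subset m <= J} -> {subset J <= m}.

(* R is local with maximal ideal m *)
Definition local_ring m : Prop :=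
  maximal_ideal m /\ forall J, maximal_ideal J -> J =i m.

Definition residue_field m : lmodType R := quotmod m.

(* N_0 with infinity, which is None *)
Definition enat := option nat.

Definition enat_le (a b : enat) : Prop :=
  match a, b with
  | _, None => True
  | None, Some _ => False
  | Some i, Some j => (i <= j)%N
  end.

Definition enat_inf (A : set nat) : enat :=
  match pselect (exists n, `[< A n >]) with
  | left exA => Some (ex_minn exA)
  | right _ => None
  end.

Definition enat_sup (A : set nat) : enat :=
  enat_inf [set n | forall l, A l -> (l <= n)%N].

Definition prime_chain (n : nat) (p : nat -> submodClosed R^o) : Prop :=
  (forall i, (i <= n)%N -> prime_ideal (p i)) /\
  (forall i, (i < n)%N ->
     {subset p i <= p i.+1} /\ ~ {subset p i.+1 <= p i}).

Definition krull_dim : enat := enat_sup [set n | exists q : nat -> _, prime_chain n q].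

Definition depth m M : enat :=
  enat_inf [set i | exists x : Ext i (residue_field m) M, x != 0].

Definition cohen_macaulay m : Prop := depth m R^o = krull_dim.

Definition MCM m M : Prop := fin_gen M /\ enat_le krull_dim (depth m M).

Definition isomorphic M N : Prop := exists f : {linear M -> N}, bijective f.

(* The type of M is dim_k Ext^t(k, M) with t = depth M; a k-vector space has
   dimension one iff it is isomorphic to k. *)
Definition type_one m M : Prop :=
  exists2 t : nat, depth m M = Some t
                 & isomorphic (Ext t (residue_field m) M) (residue_field m).

Definition dualizing_module m M : Prop :=
  [/\ MCM m M, type_one m M & fin_inj_dim M].

Definition MCM_preenvelope m M X (mu : {linear M -> X}) : Prop :=
  MCM m X /\ forall Y, MCM m Y ->
    forall nu : HomR M Y, exists phi : HomR X Y, precomp Y mu phi = nu.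

Definition MCM_envelope m M X (mu : {linear M -> X}) : Prop :=
  MCM_preenvelope m mu /\
  forall phi : {linear X -> X}, phi \o mu =1 mu -> bijective phi.

Definition unique_lifting m M X (mu : {linear M -> X}) : Prop :=
  forall Y, MCM m Y -> bijective (precomp Y mu).
End RingNotions.

Record category := Category {
  obj : Type;
  mor : obj -> obj -> Type;
  idm : forall a, mor a a;
  compm : forall a b c, mor b c -> mor a b -> mor a c;
  compmA : forall a b c d (h : mor c d) (g : mor b c) (f : mor a b),
    compm h (compm g f) = compm (compm h g) f;
  compm1 : forall a b (f : mor a b), compm f (idm a) = f;
  comp1m : forall a b (f : mor a b), compm (idm b) f = f
}.

Record functor (C D : category) := Functor {
  fobj : obj C -> obj D;
  fmor : forall a b, mor a b -> mor (fobj a) (fobj b);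
  fmor1 : forall a, fmor (idm a) = idm (fobj a);
  fmorM : forall a b c (g : mor b c) (f : mor a b),
    fmor (compm g f) = compm (fmor g) (fmor f)
}.

Definition left_adjoint (C D : category) (F : functor C D) (G : functor D C) :
    Prop :=
  exists adj : forall (c : obj C) (d : obj D),
      mor (fobj F c) d -> mor c (fobj G d),
    (forall c d, bijective (@adj c d)) /\
    (forall c c' d d' (f : mor c' c) (g : mor d d') (u : mor (fobj F c) d),
       adj c' d' (compm g (compm u (fmor F f))) =
       compm (fmor G g) (compm (adj c d u) f)).

Definition has_left_adjoint (C D : category) (G : functor D C) : Prop :=
  exists F : functor C D, left_adjoint F G.

Section FullSubcategory.
Variables (C : category) (P : obj C -> Prop).

Definition full_subcategory : category :=
  @Category {a : obj C | P a} (fun a b => mor (sval a) (sval b))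
    (fun a => idm (sval a)) (fun a b c g f => compm g f)
    (fun a b c d => @compmA C _ _ _ _) (fun a b => @compm1 C _ _)
    (fun a b => @comp1m C _ _).

Definition inclusion : functor full_subcategory C :=
  @Functor full_subcategory C sval (fun a b f => f)
    (fun a => erefl) (fun a b c g f => erefl).
End FullSubcategory.

Section ModuleCategories.
Variable R : comNzRingType.

Definition fgmod := {M : lmodType R | fin_gen M}.
Definition fgmor (M N : fgmod) := {linear sval M -> sval N}.

Definition fgid (M : fgmod) : fgmor M M := idfun.
Definition fgcomp (M N X : fgmod) (g : fgmor N X) (f : fgmor M N) : fgmor M X :=
  g \o f.

Lemma fgcompA M N X Y (h : fgmor X Y) (g : fgmor N X) (f : fgmor M N) :
  fgcomp h (fgcomp g f) = fgcomp (fgcomp h g) f.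
Proof. exact: linear_ext. Qed.

Lemma fgcomp1 M N (f : fgmor M N) : fgcomp f (fgid M) = f.
Proof. exact: linear_ext. Qed.

Lemma fg1comp M N (f : fgmor M N) : fgcomp (fgid N) f = f.
Proof. exact: linear_ext. Qed.

Definition mod_cat : category := Category fgcompA fgcomp1 fg1comp.

Definition MCM_inclusion (m : submodClosed R^o) :=
  inclusion (C := mod_cat) (fun M : fgmod => MCM m (sval M)).
End ModuleCategories.

(* Main.v *)
(** The idea is to avoid canonical duality. A module M has an MCM-envelope with
    unique lifting exactly when it has a reflection into MCM; write k for the
    residue field and W for the dualizing module.

    If depth W >= 3, let x_1, ..., x_n generate m and M = coker (R -> R^n). Then
    0 -> Hom(M, W) -> W^n -> mW -> 0 and 0 -> mW -> W -> W/mW -> 0 are exact, and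
    W/mW is nonzero and killed by m, so Ext^2(k, Hom(M, W)) <> 0.

    Conversely MCM is reflective if d = dim R is at most 2. For d = 0 every module is
    MCM. For d = 1 divide M by the common kernel of all maps to MCM modules. For d = 2
    map M to P = Hom(Hom(M, W), W) and take the smallest submodule X of P that
    contains the image and satisfies (mz <= X -> z in X). As Ext^i(k, Y) = 0 for i < 2 and Y in MCM,
    maps to Y extend uniquely along the image of M in X; and they do factor through
    that image because MCM modules are W-torsionless. The latter follows from Bass's
    theorem (Ext^i(N, W) = 0 for i > 2) by reduction modulo an element regular on Y
    and W.

    Finally a reflection X of Hom(M, W) retracts onto it: the evaluations
    Hom(M, W) -> W extend uniquely to X. *)
From Stdlib Require List.
From HB Require Import structures.
From mathcomp Require Import all_boot all_order all_algebra.
From mathcomp Require Import boolp classical_sets.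
From mathcomp Require Import freeg.
Require Import Defs.
Import GRing.Theory.
Set Implicit Arguments.
Unset Strict Implicit.
Unset Printing Implicit Defensive.
Local Open Scope ring_scope.

(** * Submodules and quotients *)

Section LinearMaps.
Variable R : comNzRingType.
Implicit Types V W M N A B C S T X Y : lmodType R.

Definition onto M N (p : M -> N) := forall y, exists x, p x = y.

Definition mklin M N (f : M -> N) (H : linear f) : {linear M -> N} :=
  HB.pack f (GRing.isLinear.Build R M N *:%R f H).

(** A total relation closed under linear combinations is single-valued once it relates 0 to 0 only.
    Diagram chases below become linear maps through this lemma. *)
Lemma lin_choice M N (Q : M -> N -> Prop) :
  (forall z, exists w, Q z w) -> (forall w, Q 0 w -> w = 0) ->
  (forall c z z' w w', Q z w -> Q z' w' -> Q (c *: z + z') (c *: w + w')) ->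
  exists g : {linear M -> N}, forall z, Q z (g z).
Proof.
move=> Qex Q0 QL; have [g gP] := choice Qex.
have gL : linear g.
  move=> c z z'.
  have := QL (- 1) _ _ _ _ (gP (c *: z + z')) (QL c _ _ _ _ (gP z) (gP z')).
  rewrite !scaleN1r addNr => h0; have h := Q0 _ h0.
  by apply/eqP; rewrite eq_sym -subr_eq0 [X in X == _]addrC; apply/eqP.
by exists (mklin gL).
Qed.

Lemma factor_surj M N V (p : {linear M -> N}) (f : {linear M -> V}) :
  onto p -> (forall z, p z = 0 -> f z = 0) ->
  exists g : {linear N -> V}, forall z, g (p z) = f z.
Proof.
move=> ps kf.
have [|w [x x0 <-]||g gP] := @lin_choice N V (fun y v => exists2 x, p x = y & f x = v).
- by move=> y; have [x xy] := ps y; exists (f x), x.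
- exact: kf.
- move=> c z z' w w' [x <- <-] [x' <- <-].
  by exists (c *: x + x'); rewrite linearP.
exists g => z; have [x xz fx] := gP (p z).
rewrite -fx; apply/eqP; rewrite -subr_eq0 -linearB; apply/eqP; apply: kf.
by rewrite linearB xz subrr.
Qed.

Lemma factor_inj A B M (i : {linear A -> B}) (f : {linear M -> B}) :
  injective i -> (forall z, exists x, i x = f z) ->
  exists g : {linear M -> A}, forall z, i (g z) = f z.
Proof.
move=> ij im.
have [//|w||g gP] := @lin_choice M A (fun z a => i a = f z); last by exists g.
  by rewrite linear0 -(linear0 i); apply: ij.
by move=> c z z' w w' h h'; rewrite !linearP h h'.
Qed.

(* Submodules as predicates: quotients and subobjects are then used only up to
   isomorphism, through [sub_ex] and [quot_ex]. *)
Definition is_sub V (P : V -> Prop) : Prop :=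
  P 0 /\ forall c z w, P z -> P w -> P (c *: z + w).

Section IsSub.
Variables (V : lmodType R) (P : V -> Prop) (sP : is_sub P).

Lemma sub0 : P 0. Proof. by case: sP. Qed.
Lemma subL c z w : P z -> P w -> P (c *: z + w).
Proof. by case: sP => _; apply. Qed.
Lemma subD z w : P z -> P w -> P (z + w).
Proof. by move=> Pz Pw; rewrite -[z]scale1r; apply: subL. Qed.
Lemma subZ c z : P z -> P (c *: z).
Proof. by move=> Pz; rewrite -[_ *: _]addr0; apply: subL => //; exact: sub0. Qed.
Lemma subN z : P z -> P (- z).
Proof. by move=> Pz; rewrite -scaleN1r; apply: subZ. Qed.
Lemma subB z w : P z -> P w -> P (z - w).
Proof. by move=> Pz Pw; apply: subD => //; apply: subN. Qed.

Let pr : V -> bool := fun z => `[< P z >].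

Let pr_closed : subsemimod_closed pr.
Proof.
split; first split; rewrite /pr.
- by rewrite unfold_in; apply/asboolP; exact: sub0.
- by move=> x y; rewrite !unfold_in => /asboolP ? /asboolP ?; apply/asboolP; apply: subD.
- by move=> c x; rewrite !unfold_in => /asboolP ?; apply/asboolP; apply: subZ.
Qed.

Lemma submod_of : exists S : submodClosed V, forall z, z \in S <-> P z.
Proof.
pose h := GRing.isSubSemiModClosed.Build R V pr pr_closed.
pose S : submodClosed V := HB.pack pr h.
by exists S => z; split=> [|Pz]; rewrite unfold_in; [move/asboolP | apply/asboolP].
Qed.

Lemma sub_ex : exists (S : lmodType R) (i : {linear S -> V}),
  injective i /\ forall z, P z <-> exists s, i s = z.
Proof.
have [S SP] := submod_of.
exists (submod S), (val : {linear submod S -> V}); split; first exact: val_inj.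
move=> z; rewrite -SP; split=> [zS|[s <-]]; last exact: valP.
by exists (exist _ z zS).
Qed.

Lemma quot_ex : exists (Q : lmodType R) (p : {linear V -> Q}),
  onto p /\ forall z, p z = 0 <-> P z.
Proof.
have [S SP] := submod_of.
exists (quotmod S), (@quot_proj R V S); split.
  by move=> y; exists (repr y); exact: (@reprK _ (quotmod S)).
move=> z; rewrite -SP -(linear0 (@quot_proj R V S)).
by split=> [/quotmodP|zS]; [rewrite subr0 | apply/quotmodP; rewrite subr0].
Qed.
End IsSub.

Lemma mem_is_sub V (S : submodClosed V) : is_sub (fun z => z \in S).
Proof. by split; [exact: rpred0 | move=> c z w zS wS; rewrite rpredD ?rpredZ]. Qed.

Lemma im_is_sub V W (f : {linear V -> W}) : is_sub (fun z => exists s, f s = z).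
Proof.
split; first by exists 0; rewrite linear0.
by move=> c _ _ [s <-] [t <-]; exists (c *: s + t); rewrite linearP.
Qed.

Lemma ker_is_sub V W (f : {linear V -> W}) : is_sub (fun z => f z = 0).
Proof. by split; [rewrite linear0 | move=> c z w h h'; rewrite linearP h h' scaler0 addr0]. Qed.

Lemma preim_is_sub V W (f : {linear V -> W}) P : is_sub P -> is_sub (fun z => P (f z)).
Proof.
move=> sP; split; first by rewrite linear0; exact: sub0.
by move=> c z w h h'; rewrite linearP; apply: subL.
Qed.

Definition scalel M (x : R) : {linear M -> M} := x \*: (idfun : {linear M -> M}).

Lemma scale_linear M (z : M) : linear (fun r : R^o => r *: z).
Proof. by move=> c a b; rewrite scalerDl scalerA. Qed.

Definition short_exact A B C (a : {linear A -> B}) (p : {linear B -> C}) : Prop :=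
  [/\ injective a, exact_at a p & onto p].

Lemma lin_inj A B (a : {linear A -> B}) : (forall z, a z = 0 -> z = 0) -> injective a.
Proof.
move=> a0 z w h; apply/eqP; rewrite -subr_eq0; apply/eqP; apply: a0.
by rewrite linearB h subrr.
Qed.

Definition regular M (x : R) := forall z : M, x *: z = 0 -> z = 0.

Lemma regular_exact M x : regular M x ->
  exists (Q : lmodType R) (p : {linear M -> Q}), short_exact (scalel M x) p.
Proof.
move=> rx; have [Q [p [ps pP]]] := quot_ex (im_is_sub (scalel M x)).
by exists Q, p; split=> //; apply: lin_inj => z; exact: rx.
Qed.
End LinearMaps.

(** * Noetherian modules *)

Section Noetherian.
Variable R : comNzRingType.
Implicit Types V W M N A B C S T X Y : lmodType R.

(** Splitting off one coefficient at a time, instead of writing a finite sum, lets arguments on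
    generators run by induction on the list. *)
Fixpoint span V (s : seq V) (z : V) : Prop :=
  if s is e :: s' then exists c, span s' (z - c *: e) else z = 0.

Lemma span_is_sub V (s : seq V) : is_sub (span s).
Proof.
elim: s => [|e s IHs]; first by split=> // c _ _ -> ->; rewrite scaler0 addr0.
split; first by exists 0; rewrite scale0r subr0; exact: sub0.
move=> c z w [a za] [b wb]; exists (c * a + b).
have -> : c *: z + w - (c * a + b) *: e = c *: (z - a *: e) + (w - b *: e).
  by rewrite scalerDl scalerBr scalerA opprD addrACA.
exact: subL.
Qed.

Lemma span_mem V (s : seq V) e : e \in s -> span s e.
Proof.
elim: s => // a s IHs; rewrite inE => /orP[/eqP ->|es].
  by exists 1; rewrite scale1r subrr; apply: sub0; exact: span_is_sub.
by exists 0; rewrite scale0r subr0; exact: IHs.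
Qed.

Lemma span_min V (s : seq V) P : is_sub P -> (forall e, e \in s -> P e) ->
  forall z, span s z -> P z.
Proof.
move=> sP; elim: s => [_ z ->|e s IHs sPs z [c /IHs h]]; first exact: sub0.
rewrite -[z](subrK (c *: e)); apply: subD => //.
  by apply: h => b bs; apply: sPs; rewrite inE bs orbT.
by apply: subZ => //; apply: sPs; rewrite mem_head.
Qed.

Lemma span_catl V (s t : seq V) z : span s z -> span (s ++ t) z.
Proof.
apply: span_min; first exact: span_is_sub.
by move=> e es; apply: span_mem; rewrite mem_cat es.
Qed.

Lemma span_catr V (s t : seq V) z : span t z -> span (s ++ t) z.
Proof.
apply: span_min; first exact: span_is_sub.
by move=> e es; apply: span_mem; rewrite mem_cat es orbT.
Qed.

Lemma span_map V W (f : {linear V -> W}) s z : span (map f s) z ->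
  exists2 y, span s y & f y = z.
Proof.
elim: s z => [z ->|e s IHs z [c /IHs[y sy fy]]]; first by exists 0; rewrite ?linear0.
exists (c *: e + y); last by rewrite linearP fy addrC subrK.
by exists c; rewrite addrAC subrr add0r.
Qed.

Lemma map_span V W (f : {linear V -> W}) s z : span s z -> span (map f s) (f z).
Proof.
elim: s z => [z /= ->|e s IHs z [c /IHs h]] /=; first by rewrite linear0.
by exists c; rewrite -linearZ -linearB.
Qed.

Definition fgsub V (P : V -> Prop) : Prop :=
  exists s, (forall e, e \in s -> P e) /\ forall z, P z -> span s z.

Lemma fin_genP V : fin_gen V <-> exists s : seq V, forall z, span s z.
Proof.
split=> [[n [e eP]]|[s sP]].
  exists (map e (enum 'I_n)) => z; have [c ->] := eP z.
  have sS := span_is_sub (map e (enum 'I_n)).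
  elim/big_ind: _ => [|x y hx hy|i _]; [exact: sub0|exact: subD|].
  by apply: subZ => //; apply: span_mem; apply: map_f; rewrite mem_enum.
exists (size s), (fun i => s`_i) => z; elim: s {sP}z (sP z) => [z ->|e s IHs z].
  by exists (fun=> 0); rewrite big_ord0.
move=> [c /IHs[d dP]].
exists (fun i : 'I_(size s).+1 => oapp d c (unlift ord0 i)).
rewrite big_ord_recl unlift_none /= -[LHS](subrK (c *: e)) dP addrC.
by congr (_ + _); apply: eq_bigr => i _; rewrite liftK.
Qed.

Definition noeth V : Prop := forall P : V -> Prop, is_sub P -> fgsub P.

Lemma noeth_fin_gen V : noeth V -> fin_gen V.
Proof.
move=> nV; have [//|s [_ sP]] := nV (fun=> True).
by apply/fin_genP; exists s => z; exact: sP.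
Qed.

Lemma lift_seq V W (f : {linear V -> W}) (P : V -> Prop) (q : seq W) :
  (forall w, w \in q -> exists2 z, P z & f z = w) ->
  exists2 u, (forall z, z \in u -> P z) & map f u = q.
Proof.
elim: q => [|b q IHq] qP; first by exists [::].
have [|u uP <-] := IHq; first by move=> a aq; apply: qP; rewrite inE aq orbT.
have [z Pz <-] := qP b (mem_head _ _); exists (z :: u) => // a.
by rewrite inE => /orP[/eqP ->|/uP].
Qed.

Lemma noeth_inj V W (f : {linear V -> W}) : injective f -> noeth W -> noeth V.
Proof.
move=> fi nW P sP; pose Q w := exists2 z, P z & f z = w.
have sQ : is_sub Q.
  split; first by exists 0; [exact: sub0 | rewrite linear0].
  by move=> c _ _ [z Pz <-] [y Py <-]; exists (c *: z + y); [exact: subL | rewrite linearP].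
have [s [sQs Qs]] := nW _ sQ.
have [t tP ts] := lift_seq sQs.
exists t; split=> // z Pz; have [|y ty /fi <- //] := @span_map _ _ f t (f z).
by rewrite ts; apply: Qs; exists z.
Qed.

Lemma noeth_surj V W (f : {linear V -> W}) : onto f -> noeth V -> noeth W.
Proof.
move=> fs nV P sP; have [s [sQs Qs]] := nV _ (preim_is_sub f sP).
exists (map f s); split=> [e /mapP[b /sQs Pb ->] //|z].
by have [y <-] := fs z; move=> /Qs; exact: map_span.
Qed.

Fixpoint vanish (T : Type) V W (f : T -> {linear V -> W}) (s : seq T) (z : V) : Prop :=
  if s is e :: s' then f e z = 0 /\ vanish f s' z else True.

Lemma vanish_is_sub (T : Type) V W (f : T -> {linear V -> W}) s : is_sub (vanish f s).
Proof.
elim: s => [|e s [h0 hL]] //; split; first by split; rewrite ?linear0.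
by move=> c z w [ez zs] [ew ws]; split; [rewrite linearP ez ew scaler0 addr0 | exact: hL].
Qed.

(** The maps embed [V] into a power of [W]. The induction on [s] builds generators of [P] modulo the
    joint kernel of the maps treated so far, so the power is never formed. *)
Lemma noeth_joint (T : Type) V W (f : T -> {linear V -> W}) (s : seq T) : noeth W ->
  (forall z, vanish f s z -> z = 0) -> noeth V.
Proof.
move=> nW s0 P sP.
suff [t [tP tE]] : exists t, (forall e, e \in t -> P e) /\
    forall z, P z -> exists2 y, span t y & vanish f s (z - y).
  exists t; split=> // z /tE[y ty /s0/eqP]; rewrite subr_eq0 => /eqP -> //.
elim: s {s0} => [|e s [t [tP tE]]].
  by exists [::]; split=> // z _; exists 0.
have sK := vanish_is_sub f s.
pose Q w := exists2 z, P z /\ vanish f s z & f e z = w.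
have sQ : is_sub Q.
  split; first by exists 0; rewrite ?linear0 //; split; exact: sub0.
  move=> c _ _ [z [Pz z0] <-] [y [Py y0] <-]; exists (c *: z + y); last by rewrite linearP.
  by split; exact: subL.
have [q [qQ Qq]] := nW _ sQ; have [u uP uq] := lift_seq qQ.
exists (t ++ u); split=> [b|z Pz].
  by rewrite mem_cat => /orP[/tP|/uP[]].
have [y ty zy] := tE z Pz.
have Py : P y by exact: span_min ty.
have [|x ux fx] := @span_map _ _ (f e) u (f e (z - y)).
  by rewrite uq; apply: Qq; exists (z - y) => //; split=> //; exact: subB.
exists (y + x).
  by apply: subD; [exact: span_is_sub|exact: span_catl|exact: span_catr].
rewrite /= opprD addrA linearB fx subrr; split=> //.
by apply: (subB sK) => //; apply: (span_min sK _ ux) => b /uP[].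
Qed.

(** Without a maximal element, choice gives a strictly ascending chain; its union is finitely
    generated, so it equals some member. This carries the noetherian inductions below. *)
Lemma noeth_max V (Q : (V -> Prop) -> Prop) : noeth V ->
  (exists2 P, is_sub P & Q P) ->
  exists P, [/\ is_sub P, Q P &
    forall P', is_sub P' -> Q P' -> (forall z, P z -> P' z) -> forall z, P' z -> P z].
Proof.
move=> nV [P0 sP0 QP0]; apply: contrapT => nomax.
pose T := {P : V -> Prop | is_sub P /\ Q P}.
have step (t : T) : exists u : T, (forall z, sval t z -> sval u z) /\
    exists2 z, sval u z & ~ sval t z.
  move: t => [P [sP QP]] /=.
  apply: contrapT => nonext; apply: nomax; exists P; split=> // P' sP' QP' PP' z P'z.
  apply: contrapT => nPz; apply: nonext.
  by exists (exist _ P' (conj sP' QP')); split=> //; exists z.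
have [nxt nP] := choice step.
pose c n := iter n nxt (exist _ P0 (conj sP0 QP0)).
have cS n : is_sub (sval (c n)) by case: (svalP (c n)).
have cM n k z : sval (c n) z -> sval (c (k + n)%N) z.
  by move=> cz; elim: k => // k; rewrite addSn /= => h; apply: (nP _).1.
pose U z := exists n, sval (c n) z.
have sU : is_sub U.
  split; first by exists 0%N; apply: sub0; exact: cS.
  move=> a z w [n zn] [k wk]; exists (n + k)%N; apply: subL => //; last exact: cM.
  by rewrite addnC; exact: cM.
have [s [sU' Us]] := nV _ sU.
have [n nP'] : exists n, forall e, e \in s -> sval (c n) e.
  elim: s sU' {Us} => [|e s IHs] sU'; first by exists 0%N.
  have [|n nP'] := IHs; first by move=> b bs; apply: sU'; rewrite inE bs orbT.
  have [k ek] := sU' e (mem_head _ _); exists (n + k)%N => b.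
  rewrite inE => /orP[/eqP ->|/nP' h]; first exact: cM.
  by rewrite addnC; exact: cM.
have [z zn] := (nP (c n)).2; apply.
by apply: (span_min (cS n) nP'); apply: Us; exists n.+1.
Qed.

(** * Finitely generated modules over a noetherian ring *)

Section NoetherianRing.
Hypothesis R_noeth : noetherian R.

Lemma ring_noeth : noeth R^o.
Proof.
move=> P sP; have [S SP] := submod_of sP.
have /fin_genP[s sE] := R_noeth S.
exists (map val s); split=> [e /mapP[b _ ->]|z /SP zS]; first exact/SP/valP.
exact: (map_span (val : {linear submod S -> R^o}) (sE (exist _ z zS))).
Qed.

(** Induction on the generators [e :: t]: the coefficients of [e], modulo [span t], in elements of
    [Q] form an ideal [I]. Lifts of generators of [I], with generators of the part of [Q] in
    [span t], generate [Q]. *)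
Lemma fin_gen_noeth V : fin_gen V -> noeth V.
Proof.
move/fin_genP => [s sV] P sP.
suff H t (Q : V -> Prop) : is_sub Q -> (forall z, Q z -> span t z) -> fgsub Q.
  by apply: (H s) => // z _; exact: sV.
elim: t Q => [|e t IHt] Q sQ Qt.
  by exists [::]; split=> // z /Qt.
have sT := span_is_sub t.
pose I (r : R^o) := exists2 z, Q z & span t (z - r *: e).
have sI : is_sub I.
  split; first by exists 0; [exact: sub0 | rewrite scale0r subr0; exact: sub0].
  move=> c a b [z Qz za] [w Qw wb]; exists (c *: z + w); first exact: subL.
  have -> : c *: z + w - (c *: a + b) *: e = c *: (z - a *: e) + (w - b *: e).
    by rewrite scalerDl scalerBr -[c *: a]/(c * a) scalerA opprD addrACA.
  exact: subL.
have [g [gI Ig]] := ring_noeth sI.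
have [q [qP qt]] : exists q : seq V, (forall y, y \in q -> Q y) /\
    forall r, span g r -> exists2 y, span q y & span t (y - r *: e).
  elim: g gI {Ig} => [|r g IHg] gI.
    exists [::]; split=> // r ->; exists 0 => //.
    by rewrite scale0r subr0; exact: sub0.
  have [|q [qQ qP]] := IHg; first by move=> b bs; apply: gI; rewrite inE bs orbT.
  have [z Qz zr] := gI r (mem_head _ _); exists (z :: q); split=> [b|a [c /qP[y qy ya]]].
    by rewrite inE => /orP[/eqP ->|/qQ].
  exists (c *: z + y); first by exists c; rewrite addrAC subrr add0r.
  have -> : c *: z + y - a *: e = c *: (z - r *: e) + (y - (a - c *: r) *: e).
    have E : (c *: r : R^o) *: e = c *: (r *: e) by rewrite scalerA.
    by rewrite scalerBl E scalerBr opprB [y + _]addrCA [RHS]addrA subrK addrA.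
  exact: subL.
have sQt : is_sub (fun z => Q z /\ span t z).
  by split; [split; exact: sub0 | move=> c z w [? ?] [? ?]; split; exact: subL].
have [|u [uQ uP]] := IHt _ sQt; first by move=> z [].
exists (q ++ u); split=> [b|z Qz]; first by rewrite mem_cat => /orP[/qP|/uQ[]].
have [c zc] := Qt z Qz; have [|y qy yc] := qt c; first by apply: Ig; exists z.
rewrite -[z](subrK y) addrC; apply: (subD (span_is_sub _)); first exact: span_catl.
apply: span_catr; apply: uP; split; first by apply: subB => //; exact: span_min qy.
have -> : z - y = (z - c *: e) - (y - c *: e) by rewrite opprB addrA subrK.
exact: subB.
Qed.

Lemma fin_gen_sub V W (f : {linear V -> W}) : injective f -> fin_gen W -> fin_gen V.
Proof. by move=> fi /fin_gen_noeth; move/(noeth_inj fi)/noeth_fin_gen. Qed.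

Lemma fin_gen_onto V W (f : {linear V -> W}) : onto f -> fin_gen V -> fin_gen W.
Proof. by move=> fs /fin_gen_noeth; move/(noeth_surj fs)/noeth_fin_gen. Qed.

(** Evaluations at generators of [M] are jointly injective maps to [W]. *)
Lemma HomR_fin_gen M W : fin_gen M -> fin_gen W -> fin_gen (HomR M W).
Proof.
move/fin_genP => [s sM] /fin_gen_noeth nW; apply: noeth_fin_gen.
pose ev (z : M) (h : HomR M W) := (h : {linear M -> W}) z.
have evL z : linear (ev z) by [].
apply: (@noeth_joint M _ _ (fun z => mklin (evL z)) s) => // h hs.
apply: linear_ext => z; pose g : {linear M -> W} := h; rewrite -[h z]/(g z).
apply: (span_min (ker_is_sub g) _ (sM z)) => e; elim: s {sM} hs => // b s IHs [bh hs].
by rewrite inE => /orP[/eqP ->|]; [exact: bh | exact: IHs].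
Qed.
End NoetherianRing.
End Noetherian.

(** * Local rings *)

Section LocalRing.
Variables (R : comNzRingType) (m : submodClosed R^o).
Hypotheses (R_local : local_ring m) (R_noeth : noetherian R).
Implicit Types V W M N A B C S T X Y : lmodType R.

(** If [x] is not a unit, an ideal maximal among the proper ones containing [x] is a maximal ideal,
    hence equal to [m]. *)
Lemma notin_m_unit (x : R^o) : x \notin m -> exists y : R, y * x = 1.
Proof.
move=> xm; apply: contrapT => noinv.
pose Q (P : R^o -> Prop) := P x /\ ~ P 1.
have [|P [sP [Px nP1] Pmax]] := @noeth_max _ _ Q (ring_noeth R_noeth).
  exists (fun r => exists y : R^o, y *: (x : R^o) = r).
    split; first by exists 0; rewrite scale0r.
    by move=> c _ _ [a <-] [b <-]; exists (c *: a + b); rewrite scalerDl scalerA.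
  split; first by exists 1; rewrite scale1r.
  by move=> [y yx]; apply: noinv; exists y.
have [S SP] := submod_of sP.
have Smax : maximal_ideal S.
  split=> [|J Jp SJ r rJ]; first by apply/negP => /SP.
  apply/SP; apply: (Pmax (fun z => z \in J) (mem_is_sub J)) => [|z /SP /SJ //|//].
  by split; [exact/SJ/SP | exact/negP].
by move: xm; rewrite -(R_local.2 S Smax) => /negP; apply; exact/SP.
Qed.

Lemma one_notin_m : (1 : R^o) \notin m. Proof. exact: R_local.1.1. Qed.

Lemma unit_1B (c : R^o) : c \in m -> exists y : R, y * (1 - c) = 1.
Proof.
move=> cm; apply: (@notin_m_unit (1 - c)); apply/negP => h; have /negP := one_notin_m; apply.
by rewrite -[1](subrK c) rpredD.
Qed.

Lemma m_mulr (a x : R^o) : x \in m -> a * x \in m.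
Proof. by move=> xm; rewrite -[a * x]/(a *: x) rpredZ. Qed.

(** This is [m] times [span s]. *)
Fixpoint mspan V (s : seq V) (z : V) : Prop :=
  if s is e :: s' then exists2 c : R^o, c \in m & mspan s' (z - c *: e) else z = 0.

Lemma mspan_is_sub V (s : seq V) : is_sub (mspan s).
Proof.
elim: s => [|e s IHs]; first by split=> // c _ _ -> ->; rewrite scaler0 addr0.
split; first by exists 0; rewrite ?rpred0 // scale0r subr0; exact: sub0.
move=> c z w [a am za] [b bm wb]; exists (c * a + b).
  by rewrite rpredD ?m_mulr.
have -> : c *: z + w - (c * a + b) *: e = c *: (z - a *: e) + (w - b *: e).
  by rewrite scalerDl scalerBr scalerA opprD addrACA.
exact: subL.
Qed.

Lemma mspan_scale V (s : seq V) (x : R^o) z : x \in m -> span s z -> mspan s (x *: z).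
Proof.
move=> xm; elim: s z => [z -> /=|e s IHs z [c /IHs h]]; first by rewrite scaler0.
by exists (x * c); [rewrite mulrC m_mulr | rewrite -scalerA -scalerBr].
Qed.

Lemma mspan_span V (s : seq V) z : mspan s z -> span s z.
Proof. by elim: s z => //= e s IHs z [c _ /IHs h]; exists c. Qed.

(** Only the list [s] is finite here: [V] may fail to be finitely generated, as for cochains modulo
    coboundaries. The coefficient [c] of the head [e] lies in [m], so [1 - c] is a unit and [e] can
    be eliminated. *)
Lemma nakayama V (B : V -> Prop) (s : seq V) : is_sub B ->
  (forall e, e \in s -> exists2 w, mspan s w & B (e - w)) -> forall e, e \in s -> B e.
Proof.
move=> sB; elim: s => // e t IHt h.
pose T z := exists2 w, mspan t w & B (z - w).
have sT : is_sub T.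
  split; first by exists 0; [apply: sub0; exact: mspan_is_sub | rewrite subr0; exact: sub0].
  move=> c z z' [w tw zw] [w' tw' zw']; exists (c *: w + w').
    by apply: subL => //; exact: mspan_is_sub.
  by rewrite opprD addrACA -scalerBr; exact: subL.
have Te : T e.
  have [w [c cm tw] ew] := h e (mem_head _ _); have [u uc] := unit_1B cm.
  rewrite -[e]scale1r -uc -scalerA; apply: subZ => //; exists (w - c *: e) => //.
  have -> : (1 - c) *: e = e - c *: e by rewrite scalerBl scale1r.
  by rewrite opprB addrA subrK.
have Tt f : f \in t -> T f.
  move=> ft; have [|w [c cm tw] ew] := h f; first by rewrite inE ft orbT.
  rewrite -[f](subrK (c *: e)); apply: (subD sT); last exact: subZ.
  by exists (w - c *: e) => //; rewrite opprB addrA subrK.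
have Bt f : f \in t -> B f by exact: (IHt Tt).
move=> f; rewrite inE => /orP[/eqP ->|/Bt //].
have [w tw ew] := Te; rewrite -[e](subrK w); apply: subD => //.
exact: (span_min sB Bt (mspan_span tw)).
Qed.

Lemma nakayama_top W : fin_gen W ->
  (forall P, is_sub P -> (forall (x : R^o) w, x \in m -> P (x *: w)) -> forall z : W, P z) ->
  forall z : W, z = 0.
Proof.
move=> /fin_genP[s sW] Wm z.
have s0 e : e \in s -> e = 0.
  move: e; apply: (nakayama (B := fun z => z = 0)).
    by split=> // c _ _ -> ->; rewrite scaler0 addr0.
  move=> e _; exists e; last exact: subrr.
  by apply: (Wm (mspan s) (mspan_is_sub s)) => x w xm; apply: mspan_scale.
by apply: (span_min _ s0 (sW z)); split=> // c _ _ -> ->; rewrite scaler0 addr0.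
Qed.

Lemma nakayama_mul W (x : R^o) : fin_gen W -> x \in m ->
  (forall z : W, exists z', z = x *: z') -> forall z : W, z = 0.
Proof.
by move=> fW xm h; apply: nakayama_top => // P sP Pm z; have [w ->] := h z; exact: Pm.
Qed.

Local Notation k := (residue_field m).
Definition res : {linear R^o -> k} := @quot_proj R R^o m.

Lemma res_onto : onto res.
Proof. by move=> y; exists (repr y); exact: (@reprK _ (quotmod m)). Qed.

Lemma res0 (x : R^o) : res x = 0 <-> x \in m.
Proof.
rewrite -(linear0 res).
by split=> [/quotmodP|xm]; [rewrite subr0 | apply/quotmodP; rewrite subr0].
Qed.

Lemma m_res (x : R^o) (y : k) : x \in m -> x *: y = 0.
Proof.
move=> xm; have [a <-] := res_onto y; rewrite -linearZ; apply/res0.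
by rewrite -[x *: a]/(x * a) mulrC m_mulr.
Qed.
End LocalRing.

(** * Vanishing of Ext *)

Section ExtVanishing.
Variable R : comNzRingType.
Implicit Types V W M N A B C S T X Y : lmodType R.

Definition syz_inc N j : {linear syzygy N j.+1 -> {freeg (syzygy N j) / R}} :=
  locked (val : {linear submod (ker (cover (syzygy N j))) -> _}).

Lemma syz_exact N j : short_exact (syz_inc N j) (cover (syzygy N j)).
Proof.
rewrite /syz_inc -lock; split; [exact: val_inj| |exact: cover_surj].
move=> y; split=> [y0|[x <-]].
  have yk : y \in ker (cover (syzygy N j)) by rewrite unfold_in; apply/eqP.
  by exists (exist _ y yk : syzygy N j.+1).
exact/eqP/(valP (x : submod (ker (cover (syzygy N j))))).
Qed.

(* Ext^i(N, M) = 0, expressed through the i-th canonical syzygy of N *)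
Definition Ext_zero i N M : Prop :=
  match i with
  | 0%N => forall (f : {linear N -> M}) z, f z = 0
  | j.+1 => forall u : {linear syzygy N j.+1 -> M},
      exists v : {linear {freeg (syzygy N j) / R} -> M}, forall z, v (syz_inc N j z) = u z
  end.

Lemma homology_zero A B C (f : {linear A -> B}) (g : {linear B -> C}) :
  (forall x : homology f g, x = 0) <-> forall y, g y = 0 -> exists x, f x = y.
Proof.
split=> [h y gy|h x].
  have yk : y \in ker g by rewrite unfold_in; apply/eqP.
  pose z : submod (ker g) := exist _ y yk.
  pose S : submodClosed (submod (ker g)) :=
  GRing.SubmodClosed.clone R (submod (ker g)) (bound_pred f (g:=g)) _.
  have := h (quot_proj S z); rewrite -(linear0 (quot_proj S)) => /quotmodP.
  by rewrite subr0 unfold_in => /asboolP.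
pose S : submodClosed (submod (ker g)) :=
  GRing.SubmodClosed.clone R (submod (ker g)) (bound_pred f (g:=g)) _.
have -> : x = quot_proj S (repr x) by exact/esym/(@reprK _ (quotmod S)).
rewrite -[RHS](linear0 (quot_proj S)); apply/quotmodP; rewrite subr0 unfold_in.
apply/asboolP; apply: h; exact/eqP/(valP (repr x : submod (ker g))).
Qed.

(** In positive degree a cocycle descends along [cover] to a map on the syzygy, and it is a
    coboundary exactly when the descended map extends to the preceding free module. *)
Lemma Ext_zeroP i N M : (forall x : Ext i N M, x = 0) <-> Ext_zero i N M.
Proof.
case: i => [|i].
  rewrite homology_zero; split=> [h f z|h y y0].
    have [|w hf] := h (f \o cover N : {linear {freeg N / R} -> M}).
      apply: linear_ext => y; rewrite -[LHS]/(f (cover N (free_diff N 0 y))).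
      have -> : cover N (free_diff N 0 y) = 0 by apply/(@cover_exact _ N 0); exists y.
      by rewrite linear0.
    have [y <-] := cover_surj z.
    by have := congr1 (fun g : {linear {freeg N / R} -> M} => g y) hf => /= <-.
  pose y' : {linear {freeg N / R} -> M} := y.
  have [|f fE] := @factor_surj _ _ _ _ (cover N) y' (@cover_surj _ N).
    move=> z /(cover_exact (i := 0))[x <-].
    exact: (congr1 (fun g : {linear _ -> M} => g x) y0).
  by exists 0; apply: linear_ext => z /=; rewrite -[y z]/(y' z) -fE h.
rewrite homology_zero /Ext_zero /syz_inc -lock; split=> [h u|h y y0].
  pose uc : {linear {freeg (syzygy N i.+1) / R} -> M} := u \o cover (syzygy N i.+1).
  have [|v vE] := h uc.
    apply: linear_ext => y; rewrite -[LHS]/(u (cover (syzygy N i.+1) (free_diff N i.+1 y))).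
    have -> : cover (syzygy N i.+1) (free_diff N i.+1 y) = 0.
      by apply/(@cover_exact _ N i.+1); exists y.
    by rewrite linear0.
  exists (v : {linear _ -> M}) => z; have [y <-] := cover_surj z.
  exact: (congr1 (fun g : {linear _ -> M} => g y) vE).
pose y' : {linear {freeg (syzygy N i.+1) / R} -> M} := y.
have [|u uE] := @factor_surj _ _ _ _ (cover (syzygy N i.+1)) y' (@cover_surj _ _).
  move=> z /cover_exact[x <-].
  exact: (congr1 (fun g : {linear _ -> M} => g x) y0).
have [v vE] := h u; exists (v : HomR _ M); apply: linear_ext => z /=.
by rewrite -[y z]/(y' z) -uE -vE.
Qed.

(** Lift [h \o cover S] to [B] by projectivity. On the syzygy the lift lands in [A]; an extension of
    that map to the free module is the correction to subtract before descending to [S]. *)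
Lemma ext1_lift S A B C (a : {linear A -> B}) (p : {linear B -> C}) (h : {linear S -> C}) :
  short_exact a p -> Ext_zero 1 S A -> exists h' : {linear S -> B}, forall z, p (h' z) = h z.
Proof.
move=> [ai ap ps] E1.
have [q qE] := free_projective (h \o cover S) ps.
have [_ sz_ex _] := syz_exact S 0.
have [|u uE] := @factor_inj _ _ _ _ a (q \o syz_inc S 0 : {linear syzygy S 1 -> B}) ai.
  move=> z; apply/ap; rewrite [p _]qE /=.
  by rewrite (proj2 (sz_ex _)) ?linear0 //; exists z.
have [v vE] := E1 u.
have [|h' h'E] := @factor_surj _ _ _ _ (cover S)
  (q \- (a \o v) : {linear _ -> B}) (@cover_surj _ S).
  move=> z /sz_ex[x <-] /=; rewrite vE uE subrr //.
exists h' => z; have [y <-] := cover_surj z.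
rewrite h'E /= linearB [p (q y)]qE /=.
by rewrite (proj2 (ap _)) ?subr0 //; exists (v y).
Qed.

(** The piece Ext^i(N, B) -> Ext^i(N, C) -> Ext^{i+1}(N, A) of the long exact sequence. *)
Lemma Ext_zero_quot i N A B C (a : {linear A -> B}) (p : {linear B -> C}) :
  short_exact a p -> Ext_zero i N B -> Ext_zero i.+1 N A -> Ext_zero i N C.
Proof.
case: i => [|i] ex_ap EB EA f.
  have [h hE] := ext1_lift f ex_ap EA.
  by move=> z; rewrite -hE EB linear0.
(* By computation [Ext_zero i.+2 N A] is [Ext_zero 1 (syzygy N i.+1) A]. *)
have [h hE] := @ext1_lift (syzygy N i.+1) _ _ _ _ _ f ex_ap EA.
by have [v vE] := EB h; exists (p \o v) => z /=; rewrite vE hE.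
Qed.

(** The piece Hom(N, C) -> Ext^1(N, A) -> Ext^1(N, B) of the same sequence. *)
Lemma Ext_zero_sub N A B C (a : {linear A -> B}) (p : {linear B -> C}) :
  short_exact a p -> Ext_zero 0 N C -> Ext_zero 1 N B -> Ext_zero 1 N A.
Proof.
move=> [ai ap ps] EC EB u.
have [v vE] := EB (a \o u); have [si sz_ex ss] := syz_exact N 0.
have [|h hE] := @factor_surj _ _ _ _ (cover N) (p \o v : {linear _ -> C}) (@cover_surj _ N).
  by move=> z /sz_ex[x <-] /=; rewrite vE; apply/ap; exists (u x).
have [|w wE] := @factor_inj _ _ _ _ a v ai; first by move=> z; apply/ap; rewrite -[p _]hE EC.
by exists w => z; apply: ai; rewrite wE vE.
Qed.

Lemma Ext_zero_retract i N A B (a : {linear A -> B}) (r : {linear B -> A}) :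
  (forall z, r (a z) = z) -> Ext_zero i N B -> Ext_zero i N A.
Proof.
move=> ra; case: i => [|i] EB f.
  by move=> z; rewrite -[f z]ra -[a (f z)]/((a \o f) z) EB linear0.
by have [v vE] := EB (a \o f); exists (r \o v) => z /=; rewrite vE /= ra.
Qed.

Lemma Ext1_extend N Y S T (a : {linear S -> T}) (p : {linear T -> N}) (g : {linear S -> Y}) :
  short_exact a p -> Ext_zero 1 N Y -> exists h : {linear T -> Y}, forall s, h (a s) = g s.
Proof.
move=> [ai ap ps] E1.
have [l lE] := free_projective (cover N) ps.
have [si sz_ex ss] := syz_exact N 0.
have [|u uE] := @factor_inj _ _ _ _ a (l \o syz_inc N 0 : {linear syzygy N 1 -> T}) ai.
  by move=> z; apply/ap; rewrite [p _]lE; apply/sz_ex; exists z.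
have [v vE] := E1 (g \o u).
(* [T] is the pushout of the free module and [S] over the syzygy, so every [t] is [l q + a s]; the
   ambiguity comes from the syzygy, where [v] and [g \o u] agree. *)
have [||c z z' w w'|h hP] := @lin_choice _ T Y
    (fun t y => exists q s, t = l q + a s /\ y = v q + g s).
- move=> t; have [q qE] := ss (p t).
  have /ap[s sE] : p (t - l q) = 0 by rewrite linearB [p (l q)]lE qE subrr.
  by exists (v q + g s), q, s; rewrite sE addrC subrK.
- move=> w [q [s [e ->]]].
  have /sz_ex[x xq] : cover N q = 0.
    have := congr1 p e; rewrite linear0 linearD [p (l q)]lE (proj2 (ap (a s))); last by exists s.
    by rewrite addr0 => ->.
  have es : u x + s = 0 by apply: ai; rewrite linearD uE /= xq -e linear0.
  by rewrite -xq vE /= -linearD es linear0.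
- move=> [q [s [-> ->]]] [q' [s' [-> ->]]]; exists (c *: q + q'), (c *: s + s').
  by rewrite !linearP !scalerDr; split; rewrite addrACA.
exists h => s; have [q [s' [e ->]]] := hP (a s).
have /sz_ex[x xq] : cover N q = 0.
  have := congr1 p e; rewrite linearD [p (l q)]lE !(proj2 (ap (a _))) ?addr0; try by eexists.
  by move=> <-.
have es : u x + s' = s by apply: ai; rewrite linearD uE /= xq -e.
by rewrite -xq vE /= -linearD es.
Qed.

(** Multiplication by [x] on the resolution lifts the zero map of [N], so it is null-homotopic. The
    homotopy appears as a factorization of [x], on a syzygy, through the inclusion into the free
    module; hence [x] kills Ext^{i+1}(N, -). *)
Lemma syz_null_homotopy (x : R) N : (forall z : N, x *: z = 0) ->
  forall i, exists t : {linear {freeg (syzygy N i) / R} -> syzygy N i.+1},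
    forall z, t (syz_inc N i z) = x *: z.
Proof.
move=> xN; elim=> [|i [t tE]].
  have [si sz_ex _] := syz_exact N 0.
  have [|t tE] := @factor_inj _ _ _ _ (syz_inc N 0) (scalel {freeg N / R} x) si.
    by move=> z; apply/sz_ex; rewrite linearZ /= xN.
  by exists t => z; apply: si; rewrite tE linearZ.
have [si sz_ex _] := syz_exact N i.+1.
have [q qE] := free_projective t (@cover_surj _ (syzygy N i.+1)).
have [|t' t'E] := @factor_inj _ _ _ _ (syz_inc N i.+1)
   (scalel {freeg (syzygy N i.+1) / R} x \- (q \o syz_inc N i \o cover (syzygy N i.+1))
      : {linear _ -> {freeg (syzygy N i.+1) / R}}) si.
  by move=> z; apply/sz_ex; rewrite linearB linearZ /= [X in _ - X]qE tE subrr.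
exists t' => z; apply: si; rewrite t'E /= (proj2 (sz_ex _)); last by exists z.
by rewrite !linear0 addr0 linearZ.
Qed.

(** The cocycle [h \o cover] is a coboundary with values in [C]. Lifting its primitive along [p] and
    then taking the coboundary gives a cocycle with values in [M]. In degree 0, [h] itself is
    zero. *)
Lemma Ext_zero_lift i N M C (p : {linear M -> C}) (h : {linear syzygy N i -> C}) :
  onto p -> Ext_zero i N C ->
  exists w : {linear {freeg (syzygy N i) / R} -> M},
    (forall z, w (syz_inc N i z) = 0) /\ forall z, p (w z) = h (cover (syzygy N i) z).
Proof.
move=> ps; case: i h => [|i] h EC.
  by exists \0; split=> // z; rewrite linear0 EC.
have [g gE] := EC h; have [g' g'E] := free_projective g ps.
exists (g' \o syz_inc N i \o cover (syzygy N i.+1)); split=> z /=.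
  have [_ sz_ex _] := syz_exact N i.+1.
  by rewrite (proj2 (sz_ex _)) ?linear0 //; exists z.
by rewrite [p _]g'E gE.
Qed.

(** As [x] kills Ext^{i+1}(N, M), the connecting map from Ext^i(N, M/xM) is onto it. *)
Lemma Ext_zero_regular (x : R) i N M C (p : {linear M -> C}) :
  (forall z : N, x *: z = 0) -> short_exact (scalel M x) p ->
  Ext_zero i N C -> Ext_zero i.+1 N M.
Proof.
move=> xN [xi xp ps] EC u.
have [t tE] := syz_null_homotopy xN i.
have [si sz_ex _] := syz_exact N i.
(* The map [u \o t] extends [x u]. Subtracting a cocycle that agrees with it modulo [xM] gives a map
   with values in [xM]; divided by [x], it extends [u]. *)
suff [v [vz pv]] : exists v : {linear {freeg (syzygy N i) / R} -> M},
    (forall z, v (syz_inc N i z) = x *: u z) /\ forall z, p (v z) = 0.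
  have [|w wE] := @factor_inj _ _ _ _ (scalel M x) v xi.
    by move=> z; apply/xp.
  by exists w => z; apply: xi; rewrite wE vz.
have [|h hE] := @factor_surj _ _ _ _ (cover (syzygy N i))
    (p \o (u \o t) : {linear _ -> C}) (@cover_surj _ _).
  move=> z /sz_ex[y <-] /=; rewrite tE linearZ; apply/xp; by exists (u y).
have [w [w0 pw]] := Ext_zero_lift h ps EC.
exists ((u \o t) \- w); split=> z /=; first by rewrite tE linearZ w0 subr0.
by rewrite linearB pw hE subrr.
Qed.

End ExtVanishing.

(** * Depth and regular elements *)

Section RegularElements.
Variables (R : comNzRingType) (m : submodClosed R^o).
Hypotheses (R_local : local_ring m) (R_noeth : noetherian R).
Implicit Types V W M N A B C S T X Y : lmodType R.
Local Notation k := (residue_field m).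

Lemma enat_infP (P : nat -> Prop) (D : enat) :
  enat_le D (enat_inf P) <-> forall i, (if D is Some n then (i < n)%N else true) -> ~ P i.
Proof.
rewrite /enat_inf; case: pselect => [exA|nex] /=; last first.
  by case: D; split=> // _ i _ Pi; apply: nex; exists i; apply/asboolP.
case: ex_minnP => t /asboolP Pt tmin; case: D => [n|]; last by split=> // /(_ t isT).
split=> [nt i ni Pi|h]; last by rewrite /enat_le leqNgt; apply/negP => /h.
by have := leq_trans ni nt; rewrite ltnNge tmin //; apply/asboolP.
Qed.

Lemma enat_inf_mem (P : nat -> Prop) t : enat_inf P = Some t -> P t.
Proof.
rewrite /enat_inf; case: pselect => // exA [<-].
by case: ex_minnP => s /asboolP.
Qed.

Lemma depth_geP M (D : enat) : enat_le D (depth m M) <->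
  forall i, (if D is Some n then (i < n)%N else true) -> Ext_zero i k M.
Proof.
rewrite enat_infP; split=> h i /h.
  by move=> nx; apply/Ext_zeroP => x; apply: contrapT => /eqP x0; apply: nx; exists x.
by move=> /Ext_zeroP E0 [x]; rewrite (E0 x) eqxx.
Qed.

Lemma depth_Ext_nonzero M t : depth m M = Some t -> ~ Ext_zero t k M.
Proof. by move/enat_inf_mem => [x x0] /Ext_zeroP E0; rewrite (E0 x) eqxx in x0. Qed.

(** A map from [k] is determined by the image of 1, which may be any element killed by [m]. *)
Lemma Ext0_socle M : Ext_zero 0 k M <->
  forall z : M, (forall x : R^o, x \in m -> x *: z = 0) -> z = 0.
Proof.
split=> [h z zm|h f y].
  pose g : {linear R^o -> M} := mklin (scale_linear z).
  have [|f fE] := @factor_surj _ _ _ _ (res m) g (@res_onto _ m).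
    by move=> x /res0 /zm.
  by have := fE 1; rewrite h => /esym; rewrite -[g 1]/(1 *: z) scale1r.
by apply: h => x xm; rewrite -linearZ m_res ?linear0.
Qed.

Lemma HomR_Ext0 M W : Ext_zero 0 k W -> Ext_zero 0 k (HomR M W).
Proof.
move=> /Ext0_socle h; apply/Ext0_socle => g gm; apply: linear_ext => z /=.
apply: h => x xm.
exact: (congr1 (fun g : {linear M -> W} => g z) (gm x xm)).
Qed.

(** For each [z] the map sending [s] to [u s z] extends to the free module because Ext^1(N, W) = 0,
    uniquely because Hom(N, W) = 0. Uniqueness makes the extension linear in [z]. *)
Lemma HomR_Ext1 N M W : Ext_zero 0 N W -> Ext_zero 1 N W -> Ext_zero 1 N (HomR M W).
Proof.
move=> E0 E1 u.
have [_ sz_ex cs] := syz_exact N 0.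
pose app (g : HomR M W) : {linear M -> W} := g.
pose ext z (v : {linear {freeg (syzygy N 0) / R} -> W}) :=
  forall s, v (syz_inc N 0 s) = app (u s) z.
have ext0 (v : {linear {freeg (syzygy N 0) / R} -> W}) :
    (forall s, v (syz_inc N 0 s) = 0) -> forall q, v q = 0.
  move=> v0 q; have [|f fE] := @factor_surj _ _ _ _ (cover N) v cs.
    by move=> z /sz_ex[x <-].
  by rewrite -fE E0.
have extL c z z' v v' : ext z v -> ext z' v' -> ext (c *: z + z') (c \*: v \+ v').
  by move=> h h' s; rewrite /= h h' linearP.
have extU z v v' : ext z v -> ext z v' -> forall q, v q = v' q.
  move=> h h' q; apply/eqP; rewrite -subr_eq0; apply/eqP.
  by apply: (ext0 (v \- v')) => s /=; rewrite h h' subrr.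
have [||c p p' g g'|h hP] := @lin_choice _ {freeg (syzygy N 0) / R} (HomR M W)
    (fun q g => forall z, exists2 v, ext z v & app g z = v q).
- move=> q.
  have [z|w [v vE ->]|c z z' w w' [v ve ->] [v' ve' ->]|g gP] :=
    @lin_choice _ M W (fun z w => exists2 v, ext z v & w = v q).
  + have uL : linear (fun s => app (u s) z) by move=> c a b; rewrite /= linearP.
    by have [v vE] := E1 (mklin uL); exists (v q), v.
  + by apply: ext0 => s; rewrite vE linear0.
  + by exists (c \*: v \+ v'); [exact: extL |].
  + by exists (g : {linear M -> W}).
- move=> g gP; apply: linear_ext => z /=; have [v _] := gP z.
  by rewrite linear0.
- move=> hg hg' z; have [v ve gz] := hg z; have [v' ve' gz'] := hg' z.
  exists v => //; rewrite linearP -gz (extU _ _ _ ve ve') -gz' //.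
exists h => s; apply: linear_ext => z.
by have [v ve gz] := hP (syz_inc N 0 s) z; rewrite -[LHS]/(app _ z) gz ve.
Qed.

Definition adjoin V (P : V -> Prop) (z : V) : V -> Prop := fun y => exists r, P (y - r *: z).

Lemma adjoin_is_sub V (P : V -> Prop) z : is_sub P -> is_sub (adjoin P z).
Proof.
move=> sP; split; first by exists 0; rewrite scale0r subr0; exact: sub0.
move=> c y w [a ya] [b wb]; exists (c * a + b).
have -> : c *: y + w - (c * a + b) *: z = c *: (y - a *: z) + (w - b *: z).
  by rewrite scalerDl scalerBr scalerA opprD addrACA.
exact: subL.
Qed.

Lemma adjoin_sub V (P : V -> Prop) z y : P y -> adjoin P z y.
Proof. by exists 0; rewrite scale0r subr0. Qed.

Lemma adjoin_mem V (P : V -> Prop) z : is_sub P -> adjoin P z z.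
Proof. by exists 1; rewrite scale1r subrr; exact: sub0. Qed.

(** Since elements outside [m] are units, [r *: z] lies in [P] exactly when [r] is in [m], so (P +
    Rz)/P is [k]. Noetherian inductions below enlarge a submodule by such steps. *)
Lemma adjoin_exact V (P : V -> Prop) z S T (i : {linear S -> V}) (i' : {linear T -> V}) :
  is_sub P -> injective i -> (forall y, P y <-> exists s, i s = y) ->
  injective i' -> (forall y, adjoin P z y <-> exists s, i' s = y) ->
  ~ P z -> (forall x : R^o, x \in m -> P (x *: z)) ->
  exists (j : {linear S -> T}) (p : {linear T -> k}), short_exact j p /\
    forall s, i' (j s) = i s.
Proof.
move=> sP ii iP ii' iP' nPz Pm.
have [|j jE] := factor_inj (f := i) ii'.
  by move=> s; apply/iP'; apply: adjoin_sub; apply/iP; exists s.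
have inm (r : R^o) : P (r *: z) -> r \in m.
  move=> Prz; apply/negPn/negP => /(notin_m_unit R_local R_noeth)[y yr]; apply: nPz.
  by rewrite -[z]scale1r -yr -scalerA; exact: subZ.
have [t|w [r Pr ->]|c t t' w w' [r Pr ->] [r' Pr' ->]|p pP] := @lin_choice _ T k
    (fun t y => exists2 r : R^o, P (i' t - r *: z) & y = res m r).
- by have [r Pr] := (iP' (i' t)).2 (ex_intro _ t erefl); exists (res m r), r.
- apply/res0; apply: inm; rewrite linear0 sub0r in Pr.
  by rewrite -[_ *: _]opprK; exact: subN.
- exists (c *: r + r'); last by rewrite linearP.
  have -> : i' (c *: t + t') - (c *: r + r' : R^o) *: z = c *: (i' t - r *: z) + (i' t' - r' *: z).
    by rewrite linearP scalerDl scalerBr -[c *: r]/(c * r) scalerA opprD addrACA.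
  exact: subL.
have pP0 t : p t = 0 <-> P (i' t).
  have [r Pr ->] := pP t; split=> [/res0 rm|Pt].
    by rewrite -[i' t](subrK (r *: z)); apply: subD => //; exact: Pm.
  apply/res0/inm; rewrite -[_ *: _](subrK (i' t)) addrC -[X in _ + X]opprB.
  exact: subB.
exists j, p; split=> //; split.
- by move=> s s' e; apply: ii; rewrite -!jE e.
- move=> t; rewrite pP0 iP; split=> -[s e]; exists s; last by rewrite -jE e.
  by apply: ii'; rewrite jE.
- move=> y; have [r <-] := @res_onto _ m y.
  have /iP'[t tE] : adjoin P z (r *: z) by exists r; rewrite subrr; exact: sub0.
  exists t; have [r' Pr' ->] := pP t; apply/eqP; rewrite -subr_eq0 -linearB; apply/eqP/res0.
  by apply: inm; rewrite scalerBl -opprB; apply: subN => //; rewrite -tE.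
Qed.

(** What prime avoidance uses of a prime ideal that does not contain [m]; the last field also forces
    properness. *)
Record prime_pred (p : R -> Prop) : Prop := PrimePred {
  prime_predD : forall a b, p a -> p b -> p (a + b);
  prime_predM : forall a b, p b -> p (a * b);
  prime_predV : forall a b, p (a * b) -> p a \/ p b;
  prime_pred_m : exists2 r : R^o, r \in m & ~ p r
}.

Lemma In_cat (T : Type) (p : T) s t :
  List.In p (s ++ t) <-> List.In p s \/ List.In p t.
Proof. by elim: s => [|a s IH] /=; [split; [right|case] | rewrite IH or_assoc]. Qed.

Lemma In_split (T : Type) (p : T) s : List.In p s -> exists s1 s2, s = s1 ++ p :: s2.
Proof.
elim: s => //= a s IH [->|/IH[s1 [s2 ->]]]; first by exists [::], s.
by exists (a :: s1), s2.
Qed.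

Lemma prime_avoidance (L : seq (R -> Prop)) : (forall p, List.In p L -> prime_pred p) ->
  exists2 x : R^o, x \in m & forall p, List.In p L -> ~ p x.
Proof.
have [n] := ubnP (size L); elim: n L => // n IHn [|p L] /=.
  by move=> _ _; exists 0; rewrite ?rpred0.
rewrite ltnS => sL Lp.
have [|x xm xL] := IHn L sL; first by move=> q qL; apply: Lp; right.
have pp : prime_pred p by apply: Lp; left.
have [px|npx] := EM (p x); last first.
  by exists x => // q [<- //|]; exact: xL.
(* If [q] is contained in [p], avoiding [p] avoids [q], and the list without [q] is shorter. *)
have [[q [qL qp]]|nqp] := EM (exists q, List.In q L /\ forall r, q r -> p r).
  have [L1 [L2 eL]] := In_split qL.
  have inL q' : List.In q' (L1 ++ L2) -> List.In q' L.
    by rewrite eL => /In_cat[?|?]; apply/In_cat; [left|right; right].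
  have [||y ym yL] := IHn (p :: L1 ++ L2).
  - by apply: leq_trans sL; rewrite eL /= !size_cat /= addnS.
  - by move=> q' [<- //|/inL ?]; apply: Lp; right.
  exists y => // q' [<-|]; first by apply: yL; left.
  rewrite eL => /In_cat[q'L|[<-|q'L]].
  - by apply: yL; right; apply/In_cat; left.
  - by move=> /qp; apply: yL; left.
  - by apply: yL; right; apply/In_cat; right.
(* Now no [q] in [L] is contained in [p]: multiply an element of [m] outside [p] by one element of
   each [q] outside [p]. Then [x + w] avoids everything, as [x] is in [p] and in no [q]. *)
have [w [wm npw wL]] : exists w : R^o, [/\ w \in m, ~ p w & forall q, List.In q L -> q w].
  have {sL xL} : forall q, List.In q L -> prime_pred q /\ exists2 r, q r & ~ p r.
    move=> q qL; split; first by apply: Lp; right.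
    apply: contrapT => h; apply: nqp; exists q; split=> // r qr.
    by apply: contrapT => npr; apply: h; exists r.
  elim: (L) => [_|q L' IH h].
    by have [w wm npw] := prime_pred_m pp; exists w.
  have [w [wm npw wL]] := IH (fun q' q'L => h q' (or_intror q'L)).
  have [_ [r qr npr]] := h q (or_introl erefl).
  exists (w * r); split.
  - by rewrite mulrC m_mulr.
  - by move=> /(prime_predV pp)[].
  - move=> q' [<-|q'L]; first by apply: prime_predM qr; exact: (h q (or_introl erefl)).1.
    by rewrite mulrC; apply: prime_predM (wL _ q'L); exact: (h q' (or_intror q'L)).1.
have subp q (a b : R) : prime_pred q -> q (a + b) -> q b -> q a.
  move=> pq qab qb; rewrite -[a](addrK b) -mulN1r; apply: prime_predD => //.
  exact: prime_predM.
exists (x + w); first exact: rpredD.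
move=> q [<-|qL]; first by rewrite addrC => h; apply: npw; exact: (subp _ _ _ pp h px).
by move=> h; apply: (xL q qL); apply: (subp _ _ w) => //; [apply: Lp; right|exact: wL].
Qed.

(** Take a submodule [P] maximal among those whose zero divisors are covered by such a list. It is
    essential, so a zero divisor on [M] is already one on [P]. *)
Lemma assoc_primes M : fin_gen M -> Ext_zero 0 k M ->
  exists L : seq (R -> Prop), (forall p, List.In p L -> prime_pred p) /\
    forall x, (forall p, List.In p L -> ~ p x) -> regular M x.
Proof.
move=> /(fin_gen_noeth R_noeth) nM /Ext0_socle M_sf.
pose Q (P : M -> Prop) := exists L : seq (R -> Prop),
  (forall p, List.In p L -> prime_pred p) /\
  forall x, (forall p, List.In p L -> ~ p x) -> forall z, P z -> x *: z = 0 -> z = 0.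
have [|P [sP [L [Lp Lreg]] Pmax]] := @noeth_max _ _ Q nM.
  exists (fun z => z = 0); last by exists [::].
  by split=> // c _ _ -> ->; rewrite scaler0 addr0.
have ess z : z != 0 -> exists2 r, r *: z != 0 & P (r *: z).
  move=> z0; apply: contrapT => noess.
  (* A maximal element among the annihilators of nonzero multiples of [z] is prime. It does not
     contain [m], because [M] has zero socle. *)
  pose Q' (I : R^o -> Prop) := exists2 r, r *: z != 0 & forall a : R^o, I a <-> a *: (r *: z) = 0.
  have annS (y : M) : is_sub (fun a : R^o => a *: y = 0).
    by split; [rewrite scale0r | move=> c a b h h'; rewrite scalerDl -scalerA h h' scaler0 addr0].
  have [|I [sI [r rz Ir] Imax]] := @noeth_max _ _ Q' (ring_noeth R_noeth).
    by exists (fun a => a *: z = 0) => //; exists 1; rewrite scale1r.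
  set y := r *: z in rz Ir.
  have py : prime_pred (fun a => a *: y = 0).
    split.
    - by move=> a b h h'; rewrite scalerDl h h' addr0.
    - by move=> a b h; rewrite -scalerA h scaler0.
    - move=> a b aby; have [|by0] := eqVneq (b *: y) 0; [by right|left].
      apply/Ir; apply: (Imax (fun a => a *: (b *: y) = 0) (annS _)).
      + by exists (b * r); rewrite -?scalerA.
      + by move=> c /Ir cy; rewrite scalerA mulrC -scalerA cy scaler0.
      + by rewrite scalerA.
    - apply: contrapT => h; move/eqP: rz; apply; apply: M_sf => x xm.
      by apply: contrapT => xy; apply: h; exists x.
  have nP a : P (a *: y) -> a *: y = 0.
    move=> Pay; apply/eqP/negPn/negP => ay; apply: noess.
    by exists (a * r); rewrite -scalerA.
  move/eqP: (rz); apply; rewrite -[y]scale1r; apply: (nP 1); rewrite scale1r.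
  (* Since [R y] meets [P] trivially, adjoining [y] costs only one more prime, the annihilator of
     [y]. *)
  apply: (Pmax (adjoin P y)); last exact: adjoin_mem.
  - exact: adjoin_is_sub.
  - exists ((fun a => a *: y = 0) :: L); split=> [p [<- //|/Lp //]|x xL w [a Pw] xw].
    have xy : ~ x *: y = 0 by apply: (xL (fun a => a *: y = 0)); left.
    have ay : a *: y = 0.
      have : (x * a) *: y = 0.
        apply: (nP (x * a)); rewrite -scalerA -[X in P X]opprK; apply: subN => //.
        by rewrite -[- _]add0r -xw -scalerBr; exact: subZ.
      by case/(prime_predV py).
    rewrite ay subr0 in Pw; apply: (Lreg x) => // p pL; apply: xL; by right.
  - by move=> w; exact: adjoin_sub.
exists L; split=> // x xL z xz; apply/eqP/negPn/negP => /ess[r rz Pz].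
move/eqP: rz; apply; apply: (Lreg x) => //.
by rewrite scalerA mulrC -scalerA xz scaler0.
Qed.

Lemma regular_exists2 M N : fin_gen M -> Ext_zero 0 k M -> fin_gen N -> Ext_zero 0 k N ->
  exists2 x : R^o, x \in m & regular M x /\ regular N x.
Proof.
move=> fM M0 fN N0.
have [L [Lp Lr]] := assoc_primes fM M0; have [L' [Lp' Lr']] := assoc_primes fN N0.
have [|x xm xL] := @prime_avoidance (L ++ L').
  by move=> p /In_cat[]; [exact: Lp | exact: Lp'].
by exists x => //; split; [apply: Lr | apply: Lr'] => p pL; apply: xL;
  apply/In_cat; [left|right].
Qed.

Lemma regular_exists M : fin_gen M -> Ext_zero 0 k M ->
  exists2 x : R^o, x \in m & regular M x.
Proof. by move=> fM M0; have [x xm [? _]] := regular_exists2 fM M0 fM M0; exists x. Qed.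
End RegularElements.

(** * Cohomology of an injective resolution *)

Section FreeCover.
Variable R : comNzRingType.
Implicit Types V W M N A B C S T X Y K P : lmodType R.

(** The canonical covers are free on the whole underlying set; row vectors serve where finite
    generation matters. *)
Lemma row_projective n : projective 'rV[R]_n.
Proof.
move=> M N p f ps; have [b bP] := choice (fun j => ps (f (delta_mx 0 j))).
have gL : linear (fun v : 'rV[R]_n => \sum_j v 0 j *: b j).
  move=> c v w; rewrite scaler_sumr -big_split; apply: eq_bigr => j _ /=.
  by rewrite !mxE scalerDl scalerA.
exists (mklin gL) => v /=; rewrite [in RHS](row_sum_delta v) !linear_sum.
by apply: eq_bigr => j _; rewrite !linearZ bP.
Qed.

Lemma row_fin_gen n : fin_gen 'rV[R]_n.
Proof. by exists n, (fun j => delta_mx 0 j) => v; exists (v 0); exact: row_sum_delta. Qed.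

Lemma row_cover W : fin_gen W -> exists n (p : {linear 'rV[R]_n -> W}), onto p.
Proof.
move=> [n [e eP]]; exists n.
have gL : linear (fun v : 'rV[R]_n => \sum_j v 0 j *: e j).
  move=> c v w; rewrite scaler_sumr -big_split; apply: eq_bigr => j _ /=.
  by rewrite !mxE scalerDl scalerA.
exists (mklin gL) => z; have [c ->] := eP z; exists (\row_j c j) => /=.
by apply: eq_bigr => j _; rewrite mxE.
Qed.

(** Transports generators along a linear relation. It is applied to the connecting relation on
    cocycles, which is not a function. *)
Lemma span_rel V W (T : V -> W -> Prop) (Q : W -> Prop) (s : seq V) :
  T 0 0 -> (forall c y g y' g', T y g -> T y' g' -> T (c *: y + y') (c *: g + g')) ->
  (forall e, e \in s -> exists2 f, Q f & T e f) ->
  exists t, (forall f, f \in t -> Q f) /\ forall y, span s y -> exists2 g, span t g & T y g.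
Proof.
move=> T0 TL; elim: s => [_|e s IHs sQ].
  by exists [::]; split=> // y ->; exists 0.
have [|t [tQ tP]] := IHs; first by move=> b bs; apply: sQ; rewrite inE bs orbT.
have [f Qf Tf] := sQ e (mem_head _ _); exists (f :: t); split=> [b|y [c /tP[g tg Tg]]].
  by rewrite inE => /orP[/eqP ->|/tQ].
exists (c *: f + g); first by exists c; rewrite addrAC subrr add0r.
by rewrite -[y](subrK (c *: e)) addrC; exact: TL.
Qed.
End FreeCover.

(** * The functors H^i(Hom(-, I)) and their comparison with Ext *)

Section InjectiveCohomology.
Variables (R : comNzRingType) (Om : lmodType R) (I : inj_resolution Om).
Implicit Types V W M N A B C S T X Y K P : lmodType R.
Local Notation J := (ir_mod I).
Local Notation d := (ir_diff I).

Definition cocycle N i (v : {linear N -> J i}) : Prop := forall z, d i (v z) = 0.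

Definition bound N i : {linear N -> J i} -> Prop :=
  match i with
  | 0%N => fun v => forall z, v z = 0
  | j.+1 => fun v => exists w : {linear N -> J j}, forall z, d j (w z) = v z
  end.

(* H^i(Hom(N, I)) = 0 *)
Definition coh_zero i N : Prop := forall v : {linear N -> J i}, cocycle v -> bound v.

Lemma ir_dd i z : d i.+1 (d i z) = 0.
Proof. by apply/ir_exact; exists z. Qed.

Lemma bound_is_sub N i : is_sub (fun v : HomR N (J i) => bound v).
Proof.
case: i => [|i]; first by split=> // c v w v0 w0 z /=; rewrite v0 w0 scaler0 addr0.
split; first by exists \0 => z; rewrite linear0.
move=> c v w [v' v'E] [w' w'E]; exists (c \*: v' \+ w') => z /=.
by rewrite linearP v'E w'E.
Qed.

Lemma bound_ext N i (v w : {linear N -> J i}) : v =1 w -> bound v -> bound w.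
Proof. by move=> vw; rewrite (linear_ext vw). Qed.

Lemma boundD N i (v w : {linear N -> J i}) : bound v -> bound w -> bound (v \+ w).
Proof. exact: (subD (bound_is_sub N i)). Qed.

Lemma bound_comp M N i (v : {linear N -> J i}) (p : {linear M -> N}) :
  bound v -> bound (v \o p).
Proof.
case: i v => [|i] v; first by move=> v0 z /=.
by move=> [w wE]; exists (w \o p) => z /=.
Qed.

Lemma bound_extend A B i (a : {linear A -> B}) (v : {linear A -> J i}) :
  injective a -> bound v ->
  exists v' : {linear B -> J i}, [/\ bound v', cocycle v' & forall z, v' (a z) = v z].
Proof.
move=> ai; case: i v => [|i] v.
  by move=> v0; exists \0; split=> // z; rewrite /= ?linear0 ?v0.
move=> [w wE]; have [w' w'E] := ir_injective w ai.
exists (d i \o w'); split; first by exists w'.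
  by move=> z; exact: ir_dd.
by move=> z /=; rewrite [w' _]w'E wE.
Qed.

(** * The long exact sequence in the first variable *)

Section ShortExact.
Variables (A B C : lmodType R) (a : {linear A -> B}) (p : {linear B -> C}).
Hypothesis ex : short_exact a p.

(** Extend [v] to [B] by injectivity of [J i]. The differential of the extension vanishes on [A],
    hence is a cocycle on [C], and a primitive of it corrects the extension. *)
Lemma cocycle_extend i (v : {linear A -> J i}) : coh_zero i.+1 C -> cocycle v ->
  exists2 v' : {linear B -> J i}, cocycle v' & forall z, v' (a z) = v z.
Proof.
have [ai ap ps] := ex; move=> XC cv; have [v' v'E] := ir_injective v ai.
have [|g gE] := factor_surj (f := d i \o v') ps.
  by move=> z /ap[y <-] /=; rewrite [v' _]v'E.
have [|w wE] := XC g.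
  by move=> z; have [y <-] := ps z; rewrite gE; exact: ir_dd.
exists (v' \- (w \o p)) => z /=; first by rewrite linearB wE gE subrr.
by rewrite [v' _]v'E (proj2 (ap _)) ?linear0 ?addr0 //; exists z.
Qed.

Lemma coh_zero_mid i : coh_zero i A -> coh_zero i C -> coh_zero i B.
Proof.
have [ai ap ps] := ex; move=> XA XC v cv.
have [|v' [bv' cv' v'E]] := bound_extend ai (XA (v \o a) _); first by move=> z; exact: cv.
have [|g gE] := factor_surj (f := v \- v') ps.
  by move=> z /ap[y <-] /=; rewrite v'E subrr.
apply: (@bound_ext _ _ ((g \o p) \+ v')) => [z /=|]; first by rewrite gE subrK.
apply: boundD => //; apply: bound_comp; apply: XC => z.
by have [y <-] := ps z; rewrite gE linearB cv cv' subrr.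
Qed.

Lemma coh_zero_sub i : coh_zero i B -> coh_zero i.+1 C -> coh_zero i A.
Proof.
move=> XB XC v /(cocycle_extend XC)[v' cv' v'E].
by apply: (@bound_ext _ _ (v' \o a) v) => //; apply: bound_comp; exact: XB.
Qed.

Lemma coh_zero_quot i : coh_zero i A -> coh_zero i.+1 B -> coh_zero i.+1 C.
Proof.
have [ai ap ps] := ex; move=> XA XB v cv.
have [|w wE] := XB (v \o p); first by move=> z; exact: cv.
have [|w' [_ cw' w'E]] := bound_extend ai (XA (w \o a) _).
  by move=> z; rewrite wE /= (proj2 (ap _)) ?linear0 //; exists z.
have [|h hE] := factor_surj (f := w \- w') ps.
  by move=> z /ap[y <-] /=; rewrite w'E subrr.
by exists h => z; have [y <-] := ps z; rewrite hE linearB wE cw' subr0.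
Qed.

Lemma coh_zero0_quot : coh_zero 0 B -> coh_zero 0 C.
Proof.
have [ai ap ps] := ex; move=> XB v cv z; have [y <-] := ps z.
by apply: (XB (v \o p)) => t; exact: cv.
Qed.
End ShortExact.

(** By exactness of [I] a cocycle takes values in the image of the previous differential, along
    which projectivity lifts it. *)
Lemma coh_zero_projective P i : projective P -> coh_zero i.+1 P.
Proof.
move=> pP v cv; have [S [s [si sP]]] := sub_ex (ker_is_sub (d i.+1)).
have [|q qE] := factor_inj (f := d i) si; first by move=> z; apply/sP; exact: ir_dd.
have [|v' v'E] := factor_inj (f := v) si; first by move=> z; apply/sP; exact: cv.
have [|w wE] := pP _ _ q v'.
  move=> y; have /ir_exact[x xE] : d i.+1 (s y) = 0 by apply/sP; exists y.
  by exists x; apply: si; rewrite qE.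
by exists w => z; rewrite -qE -v'E [q _]wE.
Qed.

Lemma coh_zero_syz i K P N (a : {linear K -> P}) (p : {linear P -> N}) :
  projective P -> short_exact a p -> coh_zero i.+2 N <-> coh_zero i.+1 K.
Proof.
move=> pP ex; have XP j := @coh_zero_projective P j pP.
by split=> h; [exact: (coh_zero_sub ex) | exact: (coh_zero_quot ex)].
Qed.

Lemma cocycle0 N (v : {linear N -> J 0}) : cocycle v ->
  exists u : {linear N -> Om}, forall z, ir_aug I (u z) = v z.
Proof.
move=> cv; apply: factor_inj; first exact: ir_aug_inj.
by move=> z; apply/ir_exact0; exact: cv.
Qed.

Lemma aug_cocycle N (u : {linear N -> Om}) : cocycle (ir_aug I \o u).
Proof. by move=> z; apply/ir_exact0; exists (u z). Qed.

(** Both sides say Ext^1(N, Om) = 0, one through the injective resolution, the other through the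
    presentation of [N]. *)
Lemma coh_zero1P K P N (a : {linear K -> P}) (p : {linear P -> N}) :
  projective P -> short_exact a p ->
  coh_zero 1 N <->
  forall u : {linear K -> Om}, exists v : {linear P -> Om}, forall z, v (a z) = u z.
Proof.
move=> pP ex; have [ai ap ps] := ex; split=> [XN u|h v cv].
  have [v' /cocycle0[u' u'E] v'E] := cocycle_extend ex XN (aug_cocycle u).
  by exists u' => z; apply: (ir_aug_inj (i0 := I)); rewrite u'E v'E.
have [|w wE] := @coh_zero_projective _ 0 pP (v \o p); first by move=> z; exact: cv.
have [|u uE] := @cocycle0 _ (w \o a).
  by move=> z; rewrite wE /= (proj2 (ap _)) ?linear0 //; exists z.
have [u' u'E] := h u.
have [|g gE] := factor_surj (f := w \- (ir_aug I \o u')) ps.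
  by move=> z /ap[y <-] /=; rewrite u'E uE subrr.
by exists g => z; have [y <-] := ps z; rewrite gE linearB wE [X in _ - X]aug_cocycle subr0.
Qed.

Lemma coh_zero_syzygy N i j : coh_zero j.+1 (syzygy N i) <-> coh_zero (i + j).+1 N.
Proof.
elim: i j => // i IHi j; rewrite addSnnS -IHi.
by rewrite (coh_zero_syz j (@free_projective _ _) (syz_exact N i)).
Qed.

(** Balance of Ext: dimension shifting along the canonical syzygies reduces to degree 1, where
    [coh_zero1P] compares the two descriptions. *)
Lemma Ext_coh_zero i N : Ext_zero i N Om <-> coh_zero i N.
Proof.
case: i => [|i].
  split=> [h v /cocycle0[u uE] z|h f z]; first by rewrite -uE h linear0.
  apply: (ir_aug_inj (i0 := I)); rewrite linear0.
  by apply: (h (ir_aug I \o f)); exact: aug_cocycle.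
rewrite -[i in coh_zero i.+1]addn0 -coh_zero_syzygy.
by rewrite (coh_zero1P (@free_projective _ _) (syz_exact N i)).
Qed.

(** * Finiteness of the cohomology and Nakayama *)

Section Local.
Variable m : submodClosed R^o.
Hypotheses (R_local : local_ring m) (R_noeth : noetherian R) (Om_fg : fin_gen Om).

(** The [J n] need not be finitely generated, but cocycles modulo coboundaries are. In degree 0 they
    are Hom(W, Om); for a presentation K -> R^k -> W, classes of degree n+1 on [W] are connecting
    images of classes of degree n on [K]. *)
Lemma coh_fin_gen n W : fin_gen W -> exists s : seq (HomR W (J n)),
  (forall e, e \in s -> cocycle (e : {linear W -> J n})) /\
  forall v : HomR W (J n), cocycle (v : {linear W -> J n}) ->
    exists2 w, span s w & bound (v - w : HomR W (J n)).
Proof.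
elim: n W => [|n IHn] W fW.
  have /fin_genP[s sP] := HomR_fin_gen R_noeth fW Om_fg.
  have postL : linear (fun u : HomR W Om => ir_aug I \o (u : {linear W -> Om}) : HomR W (J 0)).
    by move=> c u v; apply: linear_ext => z /=; rewrite linearP.
  exists (map (mklin postL) s); split=> [e /mapP[u _ ->]|v /cocycle0[u uE]].
    exact: aug_cocycle.
  exists (mklin postL u); first exact: map_span.
  by move=> z /=; rewrite uE subrr.
have [k [p ps]] := row_cover fW; have pF := @row_projective R k.
have [K [a [ai aP]]] := sub_ex (ker_is_sub p).
have ap : exact_at a p by [].
have ex : short_exact a p by [].
have [s [sc sP]] := IHn K (fin_gen_sub R_noeth ai (row_fin_gen R k)).
(* [T h g] says that the connecting map sends the class of [h] to the class of [g]. *)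
pose T (h : HomR K (J n)) (g : HomR W (J n.+1)) :=
  exists h' : {linear 'rV[R]_k -> J n}, (forall z, h' (a z) = (h : {linear K -> J n}) z) /\
    forall z, d n (h' z) = (g : {linear W -> J n.+1}) (p z).
have [||e es|t [tc tP]] := @span_rel R _ _ T
    (fun g => cocycle (g : {linear W -> J n.+1})) s.
- by exists \0; split=> z //=; rewrite linear0.
- move=> c y g y' g' [h [ha hp]] [h' [h'a h'p]]; exists (c \*: h \+ h'); split=> z /=.
    by rewrite ha h'a.
  by rewrite linearP hp h'p.
- have [h hE] := ir_injective (e : {linear K -> J n}) ai.
  have [|g gE] := factor_surj (f := d n \o h) ps.
    by move=> z /ap[y <-] /=; rewrite [h _]hE; exact: sc.
  exists g; last by exists h; split=> z; [exact: hE | rewrite gE].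
  by move=> z; have [y <-] := ps z; rewrite [X in d _ X]gE; exact: ir_dd.
exists t; split=> // v cv.
have [|w wE] := @coh_zero_projective _ n pF ((v : {linear W -> _}) \o p).
  by move=> z; exact: cv.
have [y sy [b' [_ cb' b'E]]] : exists2 y, span s y &
    exists b' : {linear 'rV[R]_k -> J n},
     [/\ bound b', cocycle b' & forall z, b' (a z) = w (a z) - (y : {linear K -> J n}) z].
  have [|y sy yb] := sP (w \o a : {linear K -> J n}).
    by move=> z; rewrite wE /= (proj2 (ap _)) ?linear0 //; exists z.
  by exists y => //; have := bound_extend ai yb.
have [g tg [y' [ya yp]]] := tP y sy; exists g => //.
have [|h hE] := factor_surj (f := (w \- y') \- b') ps.
  by move=> z /ap[x <-] /=; rewrite b'E ya subrr.
exists h => z; have [x <-] := ps z; rewrite hE /=.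
by rewrite 2!linearB wE yp cb' subr0.
Qed.

(** As H^{n+1} vanishes on [C], a cocycle [e] extends along multiplication by [x], which writes [e]
    as [x] times a cocycle. So H^n(Hom(W, I)) is [x] times itself, and Nakayama applies by
    [coh_fin_gen]. *)
Lemma coh_zero_regular n (x : R^o) W C (p : {linear W -> C}) : fin_gen W -> x \in m ->
  short_exact (scalel W x) p -> coh_zero n.+1 C -> coh_zero n W.
Proof.
move=> fW xm ex XC v cv; have [s [sc sP]] := coh_fin_gen n fW.
have sB := bound_is_sub W n.
have bs e : e \in s -> bound (e : {linear W -> J n}).
  move: e; apply: (nakayama R_local R_noeth sB) => e es.
  have [e' ce' e'E] := cocycle_extend ex XC (sc e es).
  have [w sw bw] := sP (e' : {linear W -> J n}) ce'.
  exists (x *: w); first exact: mspan_scale.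
  pose eh : (HomR W (J n) : lmodType R) := e'.
  suff -> : e - x *: w = x *: (eh - w) by exact: (subZ sB x bw).
  rewrite scalerBr; congr (_ - _); apply: linear_ext => z /=.
  by rewrite -e'E linearZ.
have [w sw bw] := sP (v : HomR W (J n)) cv.
have := subD sB bw (span_min sB bs sw); rewrite subrK; exact.
Qed.
End Local.
End InjectiveCohomology.

(** * Dimension two *)

Section DimensionTwo.
Variables (R : comNzRingType) (m : submodClosed R^o).
Hypotheses (R_local : local_ring m) (R_noeth : noetherian R).
Implicit Types V W M N A B C S T X Y L : lmodType R.
Local Notation k := (residue_field m).

Lemma regular_fin_gen : fin_gen R^o.
Proof. exact/noeth_fin_gen/ring_noeth. Qed.

Lemma residue_fin_gen : fin_gen k.
Proof. exact: (fin_gen_onto R_noeth (@res_onto _ m) regular_fin_gen). Qed.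

Lemma regular_projective : projective R^o.
Proof.
move=> M N p f ps; have [b bP] := ps (f 1).
exists (mklin (scale_linear b)) => r /=; rewrite linearZ bP -linearZ.
by congr (f _); exact: mulr1.
Qed.

(** A nonzero map from [k] is injective, because nonzero elements of [k] are classes of units. *)
Lemma residue_sub M : ~ Ext_zero 0 k M ->
  exists (a : {linear k -> M}) C (p : {linear M -> C}), short_exact a p.
Proof.
move=> nE; have [a [y ay]] : exists (a : {linear k -> M}) y, a y <> 0.
  apply: contrapT => h; apply: nE => f z; apply: contrapT => fz.
  by apply: h; exists f, z.
have [C [p [ps pP]]] := quot_ex (im_is_sub a); exists a, C, p; split=> //.
apply: lin_inj => z; have [r <-] := @res_onto _ m z => ar; apply/res0.
apply/negPn/negP => /(notin_m_unit R_local R_noeth)[u ur]; apply: ay.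
have [s <-] := @res_onto _ m y.
have -> : s = (s * u) *: (r : R^o).
  by rewrite -[RHS]/(s * u * r) -mulrA ur mulr1.
by rewrite !linearZ /= ar scaler0.
Qed.

(** The closure hypothesis says that V/P has zero socle. The maximal submodules below satisfy it,
    since an element of the socle could be adjoined to them. *)
Lemma socle_or_free V (P : V -> Prop) C (p : {linear V -> C}) :
  onto p -> (forall z, p z = 0 <-> P z) ->
  (forall z, (forall x : R^o, x \in m -> P (x *: z)) -> P z) -> Ext_zero 0 k C.
Proof.
move=> ps pP cl; apply/Ext0_socle => c cm; have [z zc] := ps c.
by rewrite -zc; apply/pP/cl => x xm; apply/pP; rewrite linearZ /= zc cm.
Qed.

Variables (Om : lmodType R) (I : inj_resolution Om).
Hypotheses (Om_fg : fin_gen Om) (Om0 : Ext_zero 0 k Om) (Om1 : Ext_zero 1 k Om).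
Local Notation J := (ir_mod I).
Local Notation d := (ir_diff I).
Local Notation coh_zero := (coh_zero I).

Lemma coh_zero_trivial n N : (forall z : N, z = 0) -> coh_zero n N.
Proof.
move=> N0 v _; apply: (@bound_ext _ _ I N n \0) => [z|]; first by rewrite (N0 z) !linear0.
exact: (sub0 (bound_is_sub I N n)).
Qed.

(** A submodule maximal for the vanishing of H^n has a quotient with zero socle, since copies of [k]
    may be adjoined. That quotient has a regular element, so [coh_zero_regular] applies to it. *)
Lemma coh_zero_devissage n : (forall N, fin_gen N -> coh_zero n.+1 N) -> coh_zero n k ->
  forall N, fin_gen N -> coh_zero n N.
Proof.
move=> Hn Hk N fN.
pose Q (P : N -> Prop) := forall S (i : {linear S -> N}), injective i ->
  (forall z, P z <-> exists s, i s = z) -> coh_zero n S.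
have [|P [sP QP Pmax]] := @noeth_max _ _ Q (fin_gen_noeth R_noeth fN).
  exists (fun z => z = 0); first by split=> // c _ _ -> ->; rewrite scaler0 addr0.
  move=> S i ii iP; apply: coh_zero_trivial => s; apply: ii; rewrite linear0.
  by apply/iP; exists s.
have [S [i [ii iP]]] := sub_ex sP; have [C [p [ps pP]]] := quot_ex sP.
have ex : short_exact i p by split=> // z; rewrite pP.
apply: (coh_zero_mid ex); first exact: QP iP.
have fC := fin_gen_onto R_noeth ps fN.
have C0 : Ext_zero 0 k C.
  apply: (socle_or_free ps pP) => z zm; apply: contrapT => nPz; apply: (nPz).
  apply: (Pmax (adjoin P z)); [exact: adjoin_is_sub| |exact: adjoin_sub|exact: adjoin_mem].
  move=> T i' ii' iP'.
  have [j [q [exj _]]] := adjoin_exact R_local R_noeth sP ii iP ii' iP' nPz zm.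
  exact: (coh_zero_mid exj (QP _ _ ii iP) Hk).
have [x xm rx] := regular_exists R_noeth fC C0.
have [D [q exq]] := regular_exact rx.
apply: (coh_zero_regular R_local R_noeth Om_fg fC xm exq); apply: Hn.
by have [_ _ qs] := exq; exact: fin_gen_onto qs fC.
Qed.

Hypotheses (I_fin : exists n, forall i, (n < i)%N -> forall z : J i, z = 0).
Hypotheses (R0 : Ext_zero 0 k R^o) (R1 : Ext_zero 1 k R^o) (R2 : ~ Ext_zero 2 k R^o).

(** Dividing [R] by a regular sequence of length two gives depth 0, while projective dimension at
    most two kills cohomology from degree three on. *)
Lemma depth0_quotient : exists B, [/\ fin_gen B, ~ Ext_zero 0 k B &
  forall n, coh_zero n.+3 B].
Proof.
have [x xm rx] := regular_exists R_noeth regular_fin_gen R0.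
have [A [p exA]] := regular_exact rx; have [_ _ ps] := exA.
have fA := fin_gen_onto R_noeth ps regular_fin_gen.
have A0 := Ext_zero_quot exA R0 R1.
have kill y : y \in m -> forall z : k, y *: z = 0 by move=> ym z; exact: m_res.
have A1 : ~ Ext_zero 1 k A by move/(Ext_zero_regular (kill x xm) exA).
have [y ym ry] := regular_exists R_noeth fA A0.
have [B [q exB]] := regular_exact ry; have [_ _ qs] := exB.
exists B; split; first exact: fin_gen_onto qs fA.
  by move/(Ext_zero_regular (kill y ym) exB).
have XR n := @coh_zero_projective _ _ I _ n regular_projective.
by move=> n; apply: (coh_zero_quot exB); apply: (coh_zero_quot exA).
Qed.

(** Bass's theorem, by descending induction on the degree. As [k] embeds in the depth 0 module [B],
    vanishing on [B] and vanishing one degree higher give vanishing on [k]; devissage does the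
    rest. *)
Lemma coh_zero_ge3 n N : fin_gen N -> coh_zero n.+3 N.
Proof.
have [n0 n0P] := I_fin.
have [B [fB B0 XB]] := depth0_quotient.
(* For [j = 0] the degree exceeds the length [n0] of the resolution; each step of the induction on
   [j] goes down one degree. *)
have H j : forall n, (n0 < n + j)%N -> forall N, fin_gen N -> coh_zero n.+3 N.
  elim: j => [|j IHj] i ij M fM.
    move=> v _; exists \0 => z; rewrite linear0; apply/esym/n0P.
    by rewrite addn0 in ij; apply: leq_trans ij _; rewrite -addn3 leq_addr.
  have Hi M' : fin_gen M' -> coh_zero i.+4 M' by apply: IHj; rewrite addSnnS.
  apply: coh_zero_devissage => //.
  have [a [C [p ex]]] := residue_sub B0; apply: (coh_zero_sub ex) => //.
  by apply: Hi; have [_ _ ps] := ex; exact: fin_gen_onto ps fB.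
by apply: (H n0.+1); rewrite addnS ltnS leq_addl.
Qed.

(** A regular element lowers by one the degree from which cohomology vanishes; [coh_zero1] repeats
    this once more. *)
Lemma coh_zero2 N : fin_gen N -> Ext_zero 0 k N -> coh_zero 2 N.
Proof.
move=> fN N0; have [x xm rx] := regular_exists R_noeth fN N0.
have [C [p ex]] := regular_exact rx; have [_ _ ps] := ex.
apply: (coh_zero_regular R_local R_noeth Om_fg fN xm ex).
exact/coh_zero_ge3/(fin_gen_onto R_noeth ps).
Qed.

Lemma coh_zero1 N : fin_gen N -> Ext_zero 0 k N -> Ext_zero 1 k N -> coh_zero 1 N.
Proof.
move=> fN N0 N1; have [x xm rx] := regular_exists R_noeth fN N0.
have [C [p ex]] := regular_exact rx; have [_ _ ps] := ex.
apply: (coh_zero_regular R_local R_noeth Om_fg fN xm ex).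
by apply: coh_zero2; [exact: fin_gen_onto ps fN | exact: Ext_zero_quot ex N0 N1].
Qed.

Hypothesis Om_depth : exists t, ~ Ext_zero t k Om.

(** Otherwise Ext^i(k, Om) would vanish for every i, against [Om_depth]. *)
Lemma coh2_residue : ~ coh_zero 2 k.
Proof.
have [[|[|[|t]]] nE] := Om_depth.
- by case: (nE Om0).
- by case: (nE Om1).
- by rewrite -Ext_coh_zero.
by case: nE; apply/(Ext_coh_zero I)/coh_zero_ge3/residue_fin_gen.
Qed.

(** Take a nonzero acyclic quotient [C] with maximal kernel. If [k] embeds in [C], then H^2 vanishes
    on [k], a contradiction. Otherwise C/xC, for [x] regular on [C], is acyclic, nonzero by
    Nakayama, and strictly smaller. *)
Lemma coh_zero_eq0 L : fin_gen L -> (forall n, coh_zero n L) -> forall z : L, z = 0.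
Proof.
move=> fL XL; apply: contrapT => /existsNP[z0 z0P].
pose Q (P : L -> Prop) := (exists z, ~ P z) /\ exists C (p : {linear L -> C}),
  [/\ onto p, forall z, p z = 0 <-> P z & forall n, coh_zero n C].
have [|P [sP [[z1 nPz1] [C [p [ps pP XC]]]] Pmax]] := @noeth_max _ _ Q (fin_gen_noeth R_noeth fL).
  exists (fun z => z = 0); first by split=> // c _ _ -> ->; rewrite scaler0 addr0.
  split; first by exists z0.
  by exists L, idfun; split=> // y; exists y.
have fC := fin_gen_onto R_noeth ps fL.
have nC : ~ forall c : C, c = 0 by move=> C0; apply: nPz1; apply/pP.
have [C0|nC0] := EM (Ext_zero 0 k C); last first.
  have [a [D [q ex]]] := residue_sub nC0; apply: coh2_residue.
  apply: (coh_zero_sub ex) => //; apply: coh_zero_ge3.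
  by have [_ _ qs] := ex; exact: fin_gen_onto qs fC.
have [x xm rx] := regular_exists R_noeth fC C0.
have [D [q exD]] := regular_exact rx; have [_ qx qs] := exD.
have XD n : coh_zero n D.
  by case: n => [|n]; [exact: (coh_zero0_quot exD) | exact: (coh_zero_quot exD)].
apply: nC => c; apply: rx; have [y <-] := ps c; rewrite -linearZ; apply/pP.
apply: (Pmax (fun z => q (p z) = 0)).
- by move: (ker_is_sub (q \o p)).
- split.
    apply: contrapT => h; apply: nPz1; apply/pP; apply: (nakayama_mul R_local R_noeth fC xm).
    move=> {}c; have [z <-] := ps c; have /qx[c' <-] : q (p z) = 0.
      by apply: contrapT => qpz; apply: h; exists z.
    by exists c'.
  exists D, (q \o p); split=> // t; have [c' <-] := qs t.
  by have [z <-] := ps c'; exists z.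
- by move=> z /pP /= ->; rewrite linear0.
- by apply/qx; exists (p y); rewrite linearZ.
Qed.

(** * Reduction modulo an element regular on [Om] *)

Section RegularElement.
Variables (x : R) (Ob : lmodType R) (pi : {linear Om -> Ob}).
Hypotheses (x_reg : regular Om x) (pi_ex : short_exact (scalel Om x) pi).

Lemma connecting_unique a z : d 0 a = 0 -> x *: a = ir_aug I z ->
  exists2 z', ir_aug I z' = a & z = x *: z'.
Proof.
move=> /ir_exact0[z' <-]; rewrite -linearZ => /(@ir_aug_inj _ _ I) <-.
by exists z'.
Qed.

(* If [x] kills [N], Hom(N, Om/xOm) is identified with Ext^1(N, Om): the class of
   [v] corresponds to [n |-> x a mod x Om], where [d a = v n]. *)
Lemma connecting_hom N (v : {linear N -> J 1}) : (forall n : N, x *: n = 0) -> cocycle v ->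
  exists w : {linear N -> Ob}, forall n, exists a z,
    [/\ d 0 a = v n, x *: a = ir_aug I z & w n = pi z].
Proof.
move=> xN cv; pose Q n y := exists a z, [/\ d 0 a = v n, x *: a = ir_aug I z & y = pi z].
apply: (@lin_choice _ N Ob Q) => [n|w [a [z [da xa ->]]]|c n n' w w'].
- have /ir_exact[a da] := cv n.
  have /ir_exact0[z za] : d 0 (x *: a) = 0 by rewrite linearZ /= da -linearZ xN linear0.
  by exists (pi z), a, z.
- rewrite linear0 in da; have [z' _ ->] := connecting_unique da xa.
  by have [_ ex _] := pi_ex; apply/ex; exists z'.
- move=> [a [z [da xa ->]]] [a' [z' [da' xa' ->]]]; exists (c *: a + a'), (c *: z + z').
  split; first by rewrite !linearP da da'.
    by rewrite linearP -xa -xa' scalerDr !scalerA mulrC.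
  by rewrite linearP.
Qed.

(** On modules killed by [x], Hom(-, Om/xOm) is Ext^1(-, Om), so the obstruction to extending [u]
    lies in Ext^2(C, Om). *)
Lemma hom_extend A N C (a : {linear A -> N}) (p : {linear N -> C}) (u : {linear A -> Ob}) :
  short_exact a p -> (forall n : N, x *: n = 0) -> coh_zero 2 C ->
  exists w : {linear N -> Ob}, forall s, w (a s) = u s.
Proof.
move=> ex xN XC; have [xi pix pis] := pi_ex.
(* Here [e] divides by [x]: [x *: e z] is the image of [z] in [J 0]. Hence [d 0 \o e] descends to
   [Ob], and [e' \o u] is the cocycle that corresponds to [u]. *)
have [e eE] := ir_injective (ir_aug I) xi.
have [|e' e'E] := factor_surj (f := d 0 \o e) pis.
  by move=> z /pix[z' <-]; rewrite /= [e _]eE; apply/ir_exact0; exists z'.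
have [|v cv vE] := @cocycle_extend _ _ I _ _ _ _ _ ex 1 (e' \o u) XC.
  by move=> s; have [z zs] := pis (u s); rewrite /= -zs e'E; exact: ir_dd.
have [w wP] := connecting_hom xN cv; exists w => s.
have [b [z [db xb ->]]] := wP (a s); have [y ys] := pis (u s).
have db0 : d 0 (b - e y) = 0 by rewrite linearB db vE /= -ys e'E subrr.
have xb0 : x *: (b - e y) = ir_aug I (z - y).
  by rewrite scalerBr xb -linearZ [e _]eE linearB.
have [z' _ zy] := connecting_unique db0 xb0.
by rewrite -ys; apply/eqP; rewrite -subr_eq0 -linearB; apply/eqP/pix; exists z'.
Qed.

(** By the same identification the class of [v] is zero. The primitive is normalized by
    [x *: b = 0], which determines it because [x] is regular on [Om]. *)
Lemma hom_zero_coh1 L : (forall n : L, x *: n = 0) ->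
  (forall (g : {linear L -> Ob}) z, g z = 0) -> coh_zero 1 L.
Proof.
move=> xL g0 v cv; have [xi pix pis] := pi_ex; have [w wP] := connecting_hom xL cv.
have [n|b [db xb]|c n n' b b' [db xb] [db' xb']|h hP] := @lin_choice _ L (J 0)
    (fun n b => d 0 b = v n /\ x *: b = 0).
- have [a [z [da xa wz]]] := wP n; rewrite g0 in wz.
  have /esym/pix[z' z'E] := wz; exists (a - ir_aug I z').
  rewrite linearB da scalerBr xa -z'E linearZ subrr; split=> //.
  by rewrite (proj2 (ir_exact0 _)) ?subr0 //; exists z'.
- rewrite linear0 in db; rewrite -(linear0 (ir_aug I)) in xb.
  have [z <- /esym xz] := connecting_unique db xb.
  by rewrite (x_reg xz) linear0.
- split; first by rewrite !linearP db db'.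
  by rewrite scalerDr scalerA mulrC -scalerA xb xb' scaler0 addr0.
by exists h => n; have [-> _] := hP n.
Qed.
End RegularElement.

(** With [x] regular on [Y] and [Om], [key] puts the common kernel K of all maps to [Om] inside xY.
    Regularity on [Om] improves this to K = xK, and Nakayama gives K = 0. *)
Lemma torsionless Y (y : Y) : fin_gen Y -> Ext_zero 0 k Y -> Ext_zero 1 k Y ->
  (forall g : {linear Y -> Om}, g y = 0) -> y = 0.
Proof.
move=> fY Y0 Y1.
have [x xm [rY rO]] := regular_exists2 R_noeth fY Y0 Om_fg Om0.
have [N [q exq]] := regular_exact rY; have [_ qx qs] := exq.
have [Ob [pi expi]] := regular_exact rO.
have Ob0 := Ext_zero_quot expi Om0 Om1.
have N0 := Ext_zero_quot exq Y0 Y1.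
have fN := fin_gen_onto R_noeth qs fY.
have YOm : Ext_zero 1 Y Om by apply/(Ext_coh_zero I); exact: coh_zero1.
have xN n : x *: n = 0 :> N by have [t <-] := qs n; rewrite -linearZ; apply/qx; exists t.
have key : forall t : Y, (forall g : {linear Y -> Om}, g t = 0) -> q t = 0.
  move=> t gt; set t' := q t.
  have ht (h : {linear N -> Ob}) : h t' = 0.
    by have [g gE] := ext1_lift (h \o q) expi YOm; rewrite -[LHS]gE gt linear0.
  (* Maps from [P] to [Ob] that kill [t'] are to be zero, as they are for [P = R t']. Adjoining a
     copy of [k] preserves this because [Ob] has zero socle. *)
  pose Q (P : N -> Prop) := P t' /\ forall S (i : {linear S -> N}), injective i ->
    (forall z, P z <-> exists s, i s = z) -> forall g : {linear S -> Ob},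
    (forall s, i s = t' -> g s = 0) -> forall s, g s = 0.
  have s0 : is_sub (fun z : N => z = 0) by split=> // c _ _ -> ->; rewrite scaler0 addr0.
  have [|P [sP [Pt QP] Pmax]] := @noeth_max _ _ Q (fin_gen_noeth R_noeth fN).
    exists (adjoin (fun z => z = 0) t'); first exact: adjoin_is_sub.
    split=> [|S i ii iP g g0 s]; first exact: adjoin_mem.
    have [r ir] : adjoin (fun z => z = 0) t' (i s) by apply/iP; exists s.
    have /iP[s1 s1t] := adjoin_mem t' s0.
    have -> : s = r *: s1.
      by apply: ii; apply/eqP; rewrite linearZ /= s1t -subr_eq0; apply/eqP.
    by rewrite linearZ /= g0 // scaler0.
  have [S [i [ii iP]]] := sub_ex sP; have [C [p [ps pP]]] := quot_ex sP.
  have ex : short_exact i p by split=> // z; rewrite pP.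
  have C0 : Ext_zero 0 k C.
    apply: (socle_or_free ps pP) => z zm; apply: contrapT => nPz; apply: (nPz).
    apply: (Pmax (adjoin P z)); [exact: adjoin_is_sub| |exact: adjoin_sub|exact: adjoin_mem].
    split=> [|T i' ii' iP' g g0 s]; first exact: adjoin_sub.
    have [j [r [[_ jr rs] jE]]] := adjoin_exact R_local R_noeth sP ii iP ii' iP' nPz zm.
    have gj : forall s, (g \o j) s = 0.
      by apply: (QP S i) => // s1 s1t; apply: g0; rewrite jE.
    have [|h hE] := factor_surj (f := g) rs; first by move=> s1 /jr[s2 <-]; exact: gj.
    by rewrite -hE; exact: Ob0.
  have XC := coh_zero2 (fin_gen_onto R_noeth ps fN) C0.
  (* Every map extends to [N] because H^2 vanishes on [C]; by [ht] it kills [t'], so it is zero by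
     the choice of [P]. *)
  have g0 (g : {linear S -> Ob}) s : g s = 0.
    have [h hE] := hom_extend expi g ex xN XC.
    by apply: (QP S i) => // s1 s1t; rewrite -hE s1t.
  have xS s : x *: s = 0 :> S by apply: ii; rewrite linearZ /= xN linear0.
  have fS := fin_gen_sub R_noeth ii fN.
  have S0 : Ext_zero 0 k S.
    move/Ext0_socle: N0 => N0; apply/Ext0_socle => s sm; apply: ii; rewrite linear0.
    by apply: N0 => r rm; rewrite -linearZ sm // linear0.
  have /iP[s <-] := Pt; rewrite (@coh_zero_eq0 S fS _ s) ?linear0 //.
  (* [S] is acyclic: degree 1 since Hom(S, Ob) = 0, degree 2 by positive depth, and degree 0 because
     [x] kills [S] but is regular on [Om]. *)
  move=> [|[|[|n]]]; [|exact: (hom_zero_coh1 rO expi)|exact: coh_zero2|exact: coh_zero_ge3].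
  move=> v /cocycle0[u uE] z; rewrite -uE (rO (u z)) ?linear0 //.
  by rewrite -linearZ xS linear0.
have sK : is_sub (fun t : Y => forall g : {linear Y -> Om}, g t = 0).
  by split=> [g|c t t' h h' g]; rewrite ?linear0 ?linearP ?h ?h' ?scaler0 ?addr0.
move=> gy; have [S [i [ii iP]]] := sub_ex sK.
have /iP[s <-] := gy.
rewrite (nakayama_mul R_local R_noeth (fin_gen_sub R_noeth ii fY) xm _ s) ?linear0 // => z.
have gz : forall g : {linear Y -> Om}, g (i z) = 0 by apply/iP; exists z.
have /qx[t tz] := key _ gz.
have /iP[z' z't] : forall g : {linear Y -> Om}, g t = 0.
  by move=> g; apply: rO; rewrite -linearZ [_ *: t]tz gz.
by exists z'; apply: ii; rewrite linearZ /= z't -tz.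
Qed.

Definition depth_ge2 Y : Prop := [/\ fin_gen Y, Ext_zero 0 k Y & Ext_zero 1 k Y].

(** [X] is obtained as a maximal submodule of the bidual to which maps from the image of [M] still
    extend uniquely. Maximality makes the socle of P/X zero, so [X] has depth at least two like
    [P]. *)
Lemma reflection_dim2 M : fin_gen M -> exists X (mu : {linear M -> X}),
  depth_ge2 X /\ forall Y, depth_ge2 Y -> bijective (precomp Y mu).
Proof.
move=> fM; pose P := HomR (HomR M Om) Om : lmodType R.
have fP : fin_gen P by do 2!apply: HomR_fin_gen => //.
have P0 : Ext_zero 0 k P by exact: HomR_Ext0.
have P1 : Ext_zero 1 k P by exact: HomR_Ext1.
have evL1 z : linear (fun h : HomR M Om => (h : {linear M -> Om}) z) by [].
have evL : linear (fun z => mklin (evL1 z) : P).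
  by move=> c z z'; apply: linear_ext => h /=; rewrite linearP.
pose ev : {linear M -> P} := mklin evL.
have evK z : ev z = 0 -> forall h : {linear M -> Om}, h z = 0.
  by move=> ez h; exact: (congr1 (fun g : {linear HomR M Om -> Om} => g h) ez).
pose Q (P' : P -> Prop) := (forall z, P' (ev z)) /\
  forall S (i : {linear S -> P}), injective i -> (forall z, P' z <-> exists s, i s = z) ->
  forall Y, depth_ge2 Y ->
    (forall f : {linear M -> Y}, (forall z, ev z = 0 -> f z = 0) ->
      exists g : {linear S -> Y}, forall z s, i s = ev z -> g s = f z) /\
    (forall g : {linear S -> Y}, (forall z s, i s = ev z -> g s = 0) -> forall s, g s = 0).
have [|P' [sP' [P'ev QP'] P'max]] := @noeth_max _ _ Q (fin_gen_noeth R_noeth fP).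
  exists (fun y => exists z, ev z = y); first exact: im_is_sub.
  split=> [z|S i ii iP Y _]; first by exists z.
  have [|j jE] := factor_inj (f := ev) ii; first by move=> z; apply/iP; exists z.
  have js : onto j.
    move=> s; have [z zs] : exists z, ev z = i s by apply/iP; exists s.
    by exists z; apply: ii; rewrite jE.
  split=> [f fK|g g0 s]; last by have [z <-] := js s; apply: (g0 z).
  have [|g gE] := factor_surj (f := f) js.
    by move=> z jz; apply: fK; rewrite -jE jz linear0.
  by exists g => z s; rewrite -jE => /ii ->.
have [X [i [ii iP]]] := sub_ex sP'; have [C [p [ps pP]]] := quot_ex sP'.
have ex : short_exact i p by split=> // z; rewrite pP.
have C0 : Ext_zero 0 k C.
  apply: (socle_or_free ps pP) => z zm; apply: contrapT => nPz; apply: (nPz).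
  apply: (P'max (adjoin P' z)); [exact: adjoin_is_sub| |exact: adjoin_sub|exact: adjoin_mem].
  split=> [y|T i' ii' iP' Y dY]; first by apply: adjoin_sub; exact: P'ev.
  have [j [q [exj jE]]] := adjoin_exact R_local R_noeth sP' ii iP ii' iP' nPz zm.
  have [_ Y0 Y1] := dY; have [_ jq qs] := exj; have [Qf Qg] := QP' X i ii iP Y dY.
  have iev y : exists s, i s = ev y by apply/iP.
  (* The enlarged module modulo the old one is [k]: Ext^1(k, Y) = 0 extends maps and Hom(k, Y) = 0
     makes the extension unique. *)
  split=> [f fK|g g0].
    have [g gE] := Qf f fK; have [h hE] := Ext1_extend g exj Y1.
    exists h => y t ty; have [s sy] := iev y.
    have -> : t = j s by apply: ii'; rewrite jE sy.
    by rewrite hE; exact: gE.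
  have gj : forall s, (g \o j) s = 0 by apply: Qg => y s sy; apply: (g0 y); rewrite jE.
  have [|h hE] := factor_surj (f := g) qs; first by move=> t /jq[s <-]; exact: gj.
  by move=> t; rewrite -hE; exact: Y0.
have [|mu muE] := factor_inj (f := ev) ii; first by move=> z; apply/iP.
exists X, mu; split.
  split; [exact: fin_gen_sub ii fP| |exact: Ext_zero_sub ex C0 P1].
  move/Ext0_socle: P0 => P0; apply/Ext0_socle => s sm; apply: ii; rewrite linear0.
  by apply: P0 => r rm; rewrite -linearZ sm // linear0.
move=> Y dY; have [Qf Qg] := QP' X i ii iP Y dY; have [fY Y0 Y1] := dY.
have ext (f : HomR M Y) : exists g : HomR X Y, precomp Y mu g = f.
  have [|g gE] := Qf f.
    move=> z /evK hz; apply: torsionless => // h; exact: (hz (h \o (f : {linear M -> Y}))).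
  by exists g; apply: linear_ext => z /=; exact: gE.
have [inv invP] := choice ext; exists inv => // g; apply: linear_ext => s; apply/eqP.
rewrite -subr_eq0; apply/eqP; apply: (Qg (_ \- _)) => z t tz /=.
have -> : t = mu z by apply: ii; rewrite muE.
have := congr1 (fun g : {linear M -> Y} => g z) (invP (precomp Y mu g)) => /= ->.
by rewrite subrr.
Qed.
End DimensionTwo.

(** * Reflections and envelopes *)

Section Reflections.
Variables (R : comNzRingType) (m : submodClosed R^o).
Implicit Types M N X Y : lmodType R.

Definition reflective : Prop := forall M, fin_gen M ->
  exists X (mu : {linear M -> X}), MCM m X /\ unique_lifting m mu.

Local Notation modR := (mod_cat R).
Local Notation mcmR := (full_subcategory (fun M : obj modR => MCM m (sval M))).

(** [mu] is the unit; naturality in the second argument identifies the adjunction bijection with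
    precomposition by [mu]. *)
Lemma left_adjoint_reflective : has_left_adjoint (MCM_inclusion m) -> reflective.
Proof.
move=> [F [adj [adj_bij adj_nat]]] M fM.
pose c : obj modR := exist _ M fM.
pose X : obj mcmR := fobj F c.
pose mu : {linear M -> sval (sval X)} := adj c X (@idm mcmR X).
exists (sval (sval X)), mu; split; first exact: (svalP X).
move=> Y mY; have fY : fin_gen Y by case: mY.
pose y : obj mcmR := exist _ (exist _ Y fY) mY.
suff -> : precomp Y mu = adj c y by apply: (adj_bij c y).
apply: funext => g; apply: linear_ext => z /=.
have := adj_nat c c X y (@idm modR c) (g : @mor mcmR X y) (@idm mcmR X).
rewrite (fmor1 F) (@compm1 mcmR) (@compm1 mcmR) (@compm1 modR).
by move/(congr1 (fun h : {linear M -> Y} => h z)) => ->.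
Qed.

(** Reflections are chosen for all objects at once, and uniqueness of liftings gives the functor
    laws. *)
Lemma reflective_left_adjoint : reflective -> has_left_adjoint (MCM_inclusion m).
Proof.
move=> refl.
have ex (M : obj modR) : exists X : {X : obj mcmR & @mor modR M (sval X)},
    unique_lifting m (tagged X).
  case: M => M fM; have [X [mu [mX ul]]] := refl M fM.
  have fX : fin_gen X by case: mX.
  by exists (existT _ (exist _ (exist _ X fX) mX : obj mcmR) mu).
pose F0 (M : obj modR) : obj mcmR := tag (sval (cid (ex M))).
pose mu (M : obj modR) : @mor modR M (sval (F0 M)) := tagged (sval (cid (ex M))).
have XP (M : obj modR) : unique_lifting m (mu M) := svalP (cid (ex M)).
have lift_ex (M N : obj modR) (f : @mor modR M N) :
    exists g : @mor mcmR (F0 M) (F0 N), @compm modR _ _ _ g (mu M) = compm (mu N) f.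
  have [inv _ invK] := XP M _ (svalP (F0 N)).
  by exists (inv (compm (mu N) f)); exact: invK.
have lift_uniq (M : obj modR) (Y : obj mcmR) (g g' : @mor mcmR (F0 M) Y) :
    @compm modR _ _ _ g (mu M) = @compm modR _ _ _ g' (mu M) -> g = g'.
  by have [inv gK _] := XP M _ (svalP Y); exact: (can_inj gK).
have [lift liftP] : {lift : forall M N : obj modR, @mor modR M N -> @mor mcmR (F0 M) (F0 N) |
    forall (M N : obj modR) f, @compm modR _ _ _ (lift M N f) (mu M) = compm (mu N) f}.
  exists (fun (M N : obj modR) f => sval (cid (lift_ex M N f))) => M N f.
  exact: svalP (cid (lift_ex M N f)).
have lift1 (M : obj modR) : lift M M (idm M) = idm (F0 M).
  by apply: lift_uniq; rewrite liftP (@compm1 modR) (@comp1m modR).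
have liftM (M N L : obj modR) (g : @mor modR N L) (f : @mor modR M N) :
    lift M L (compm g f) = compm (lift N L g) (lift M N f).
  apply: lift_uniq; rewrite liftP.
  by rewrite -[RHS](@compmA modR) liftP !(@compmA modR) liftP.
exists (@Functor modR mcmR F0 lift lift1 liftM).
exists (fun c e u => @compm modR _ _ _ u (mu c)); split=> [c e|c c' e e' f g u].
  exact: (XP c _ (svalP e)).
apply: linear_ext => z.
have lz := congr1 (fun h : {linear sval c' -> sval (sval (F0 c))} => h z) (liftP c' c f).
pose gu : {linear sval (sval (F0 c)) -> sval (sval e')} :=
  (g : {linear sval (sval e) -> sval (sval e')}) \o
    (u : {linear sval (sval (F0 c)) -> sval (sval e)}).
exact: (congr1 gu lz).
Qed.

Lemma reflective_envelope : reflective -> forall M, fin_gen M ->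
  exists X (mu : {linear M -> X}), MCM_envelope m mu /\ unique_lifting m mu.
Proof.
move=> refl M fM; have [X [mu [mX ul]]] := refl M fM; exists X, mu; split=> //; split.
  by split=> // Y mY nu; have [inv _ invK] := ul Y mY; exists (inv nu).
move=> phi phimu; have [inv muK _] := ul X mX.
have -> : phi = idfun.
  by apply: (can_inj muK); apply: linear_ext => z /=; exact: phimu.
by exists idfun.
Qed.

Lemma MCM_retract M N (a : {linear M -> N}) (r : {linear N -> M}) :
  (forall z, r (a z) = z) -> fin_gen M -> MCM m N -> MCM m M.
Proof.
move=> ra fM [_ /depth_geP EN]; split=> //; apply/depth_geP => i /EN.
exact: Ext_zero_retract.
Qed.

Lemma reflective_dual (Om : lmodType R) : noetherian R -> MCM m Om -> reflective ->
  forall M, fin_gen M -> MCM m (HomR M Om).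
Proof.
move=> R_noeth mOm refl M fM.
have fH : fin_gen (HomR M Om) by apply: HomR_fin_gen => //; case: mOm.
have [X [mu [mX ul]]] := refl _ fH; have [inv invK muK] := ul Om mOm.
pose ev z : {linear HomR M Om -> Om} :=
  mklin (f := fun h : HomR M Om => (h : {linear M -> Om}) z) (fun _ _ _ => erefl).
have invE z y : inv (ev z) (mu y) = (y : {linear M -> Om}) z.
  exact: (congr1 (fun g : {linear HomR M Om -> Om} => g y) (muK (ev z))).
(* Extensions of evaluations are unique, so they depend linearly on [z] and assemble to a retraction
   of [mu]. *)
have invL x : linear (fun z => inv (ev z) x).
  move=> c z z'.
  suff -> : inv (ev (c *: z + z')) = c \*: inv (ev z) \+ inv (ev z') by [].
  apply: (can_inj invK); apply: linear_ext => y.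
  by rewrite -[LHS]/(inv _ (mu y)) -[RHS]/(c *: inv _ (mu y) + inv _ (mu y)) !invE linearP.
have rL : linear (fun x => mklin (invL x) : HomR M Om).
  by move=> c x x'; apply: linear_ext => z /=; rewrite linearP.
apply: (MCM_retract (a := mu) (r := mklin rL)) => // y.
by apply: linear_ext => z; exact: invE.
Qed.
End Reflections.

(** * The implications that involve the Krull dimension *)

Section MainImplications.
Variables (R : comNzRingType) (m : submodClosed R^o) (Om : lmodType R).
Hypotheses (R_local : local_ring m) (R_noeth : noetherian R).
Hypotheses (R_CM : cohen_macaulay m) (Om_dual : dualizing_module m Om).
Implicit Types M N X Y : lmodType R.
Local Notation k := (residue_field m).

Lemma dual_MCM_dim_le2 : (forall M, fin_gen M -> MCM m (HomR M Om)) ->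
  enat_le (krull_dim R) (Some 2%N).
Proof.
move=> Hdual; have [[fOm mOm] [t dOm _] _] := Om_dual.
(* [type_one] makes the depth of [Om] finite, and this depth bounds the dimension. *)
have [d krE] : exists d, krull_dim R = Some d.
  by rewrite dOm in mOm; case: (krull_dim R) mOm => // d _; exists d.
rewrite krE; apply: contrapT => /negP; rewrite -ltnNge => d3.
have E3 Y : MCM m Y -> forall i, (i < 3)%N -> Ext_zero i k Y.
  move=> [_]; rewrite krE => /depth_geP EY i i3; apply: EY; exact: leq_trans d3.
have Om0 : Ext_zero 0 k Om by apply: E3.
have Om1 : Ext_zero 1 k Om by apply: E3.
have [s [sm ms]] := ring_noeth R_noeth (mem_is_sub m).
pose n := size s; pose xv : 'rV[R]_n := \row_j s`_j.
have [M [p [ps pP]]] := quot_ex (im_is_sub (mklin (scale_linear xv))).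
have fM := fin_gen_onto R_noeth ps (@row_fin_gen R n).
pose F := HomR 'rV[R]_n Om : lmodType R.
have F1 : Ext_zero 1 k F by exact: HomR_Ext1.
have H2 : Ext_zero 2 k (HomR M Om) by apply: E3 => //; exact: Hdual.
(* On tuples w in Om^n, [ev] is the sum of the s_j w_j, so its image [S] is [m Om] and its kernel is
   Hom(M, Om). *)
pose ev : {linear F -> Om} :=
  mklin (f := fun h : F => (h : {linear 'rV[R]_n -> Om}) xv) (fun _ _ _ => erefl).
have [S [i [ii iP]]] := sub_ex (im_is_sub ev).
have [|q qE] := factor_inj (f := ev) ii; first by move=> h; apply/iP; exists h.
have exq : short_exact (precomp Om p) q.
  split.
  - apply: lin_inj => h hp; apply: linear_ext => z; have [v <-] := ps z.
    exact: (congr1 (fun g : {linear 'rV[R]_n -> Om} => g v) hp).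
  - move=> h; split=> [qh|[g <-]].
      have hx : (h : {linear 'rV[R]_n -> Om}) xv = 0 by rewrite -[LHS]qE qh linear0.
      have [|g gE] := factor_surj (f := (h : {linear 'rV[R]_n -> Om})) ps.
        by move=> z /pP[r <-] /=; rewrite linearZ /= hx scaler0.
      by exists g; exact: linear_ext.
    apply: ii; rewrite qE linear0 -[LHS]/((g : {linear M -> Om}) (p xv)).
    by rewrite (proj2 (pP xv)) ?linear0 //; exists 1; exact: scale1r.
  - move=> y; have /iP[h hy] : exists y', i y' = i y by exists y.
    by exists h; apply: ii; rewrite qE.
have S1 : Ext_zero 1 k S by exact: (Ext_zero_quot exq).
have [Q [r [rs rP]]] := quot_ex (im_is_sub ev).
have exr : short_exact i r by split=> // z; rewrite rP iP.
have /Ext0_socle Q0 : Ext_zero 0 k Q by exact: (Ext_zero_quot exr).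
have projL (j : 'I_n) (w : Om) : linear (fun v : 'rV[R]_n => v 0 j *: w).
  by move=> c a b; rewrite !mxE scalerDl scalerA.
have im_m (x : R^o) w : x \in m -> exists h, ev h = x *: w.
  move=> xm; pose P (x : R^o) := exists h, ev h = x *: w.
  have sP : is_sub P.
    split; first by exists 0; rewrite linear0 scale0r.
    move=> c a b [h hE] [h' h'E]; exists (c *: h + h').
    by rewrite linearP hE h'E scalerDl scalerA.
  apply: (span_min sP _ (ms x xm)) => a /(nthP 0)[j js <-].
  by exists (mklin (projL (Ordinal js) w)); rewrite /= mxE.
(* [m] kills Q = Om/S, whose socle is zero, so Q = 0. *)
have ev_onto z : exists h, ev h = z.
  apply/rP; apply: Q0 => x xm; rewrite -linearZ; apply/rP; exact: im_m.
have Om_zero : forall z : Om, z = 0.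
  apply: (nakayama_top R_local R_noeth fOm) => P sP Pm z; have [h <-] := ev_onto z.
  pose h' : {linear 'rV[R]_n -> Om} := h; rewrite -[ev h]/(h' xv) [xv]row_sum_delta linear_sum.
  apply: big_ind => [|a b|j _]; [exact: sub0|exact: subD|].
  by rewrite linearZ mxE; apply: Pm; apply: sm; exact: mem_nth.
apply: (depth_Ext_nonzero dOm); case: (t) => [|j] u; first by move=> z; exact: Om_zero.
by exists \0 => z; rewrite [RHS]Om_zero.
Qed.

Lemma reflective_dim_le2 : enat_le (krull_dim R) (Some 2%N) -> reflective m.
Proof.
have [[fOm mOm] [t dOm _] [I [n In]]] := Om_dual.
have ndOm := depth_Ext_nonzero dOm.
case krE: (krull_dim R) => [[|[|[|d]]]|] //= _ M fM.
(* In dimension 0 the depth condition is empty. *)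
- exists M, idfun; split; first by split=> //; rewrite krE; apply/depth_geP.
  by move=> Y _; exists id => g; exact: linear_ext.
- have MCM1 Y : MCM m Y <-> fin_gen Y /\ Ext_zero 0 k Y.
    rewrite /MCM krE depth_geP; split=> -[fY EY]; split=> //; first exact: EY.
    by case.
  (* In dimension 1 being MCM means zero socle, and M/T inherits this from the targets of the maps
     that define [T]. *)
  pose T (z : M) := forall Y, MCM m Y -> forall f : {linear M -> Y}, f z = 0.
  have sT : is_sub T.
    split=> [Y _ f|c z w Tz Tw Y mY f]; first exact: linear0.
    by rewrite linearP (Tz Y) ?(Tw Y) ?scaler0 ?addr0.
  have [X [mu [mus muT]]] := quot_ex sT; exists X, mu; split.
    apply/MCM1; split; first exact: fin_gen_onto mus fM.
    apply: (socle_or_free mus muT) => z zm Y mY f.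
    have [_ /Ext0_socle] := (MCM1 Y).1 mY; apply=> x xm.
    by rewrite -linearZ; exact: (zm x xm).
  move=> Y mY.
  have ext (f : HomR M Y) : exists g : HomR X Y, precomp Y mu g = f.
    have [|g gE] := factor_surj (f := (f : {linear M -> Y})) mus.
      by move=> z /muT; apply.
    by exists g; exact: linear_ext.
  have [inv invP] := choice ext; exists inv => // g; apply: linear_ext => x.
  have [z <-] := mus x.
  exact: (congr1 (fun h : {linear M -> Y} => h z) (invP (precomp Y mu g))).
- have MCM2 Y : MCM m Y <-> depth_ge2 m Y.
    rewrite /MCM krE depth_geP; split=> [[fY EY]|[fY E0 E1]]; first by split=> //; exact: EY.
    by split=> // -[|[]].
  have [_ Om0 Om1] := (MCM2 Om).1 (conj fOm mOm).
  (* Bass's argument needs a regular sequence on [R] that ends in depth exactly 0; this is where the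
     Cohen-Macaulay hypothesis enters. *)
  have dR : depth m R^o = Some 2%N by rewrite R_CM krE.
  have R2 := depth_Ext_nonzero dR.
  have /depth_geP RE : enat_le (Some 2%N) (depth m R^o) by rewrite dR.
  have [X [mu [dX muP]]] := reflection_dim2 R_local R_noeth fOm Om0 Om1
    (ex_intro _ n In) (RE 0%N isT) (RE 1%N isT) R2 (ex_intro _ t ndOm) fM.
  by exists X, mu; split; [exact/MCM2 | move=> Y /MCM2; exact: muP].
Qed.
End MainImplications.

Theorem theoremB (R : comNzRingType) (m : submodClosed R^o)
    (Omega : lmodType R)
    (R_local : local_ring m) (R_noetherian : noetherian R)
    (R_CM : cohen_macaulay m) (Omega_dualizing : dualizing_module m Omega) :
  [<-> forall M : lmodType R, fin_gen M -> MCM m (HomR M Omega);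
       enat_le (krull_dim R) (Some 2%N);
       has_left_adjoint (MCM_inclusion m);
       forall M : lmodType R, fin_gen M ->
         exists (X : lmodType R) (mu : {linear M -> X}),
           MCM_envelope m mu /\ unique_lifting m mu].
Proof.
have mOm : MCM m Omega by case: Omega_dualizing.
split; first exact: (dual_MCM_dim_le2 R_local R_noetherian Omega_dualizing).
split=> [dim2|].
  apply: reflective_left_adjoint.
  exact: (reflective_dim_le2 R_local R_noetherian R_CM Omega_dualizing dim2).
split=> [/left_adjoint_reflective|env]; first exact: reflective_envelope.
apply: reflective_dual => // M fM.
by have [X [mu [[[mX _] _] ul]]] := env M fM; exists X, mu.
Qed.
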